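(* Let $N\ge 1$, let $p\in\beta\mathbb N$ be an idempotent ultrafilter and let $U\in\mathcal U(\mathcal H)$ be a unitary operator on a Hilbert space $\mathcal H$. Then there exists a unique (up to reindexing) finite or countably infinite decomposition $$\mathcal H=\bigoplus_{k\ge 1}\mathcal H^{(N)}_k$$ into an orthogonal direct sum of nonzero closed $U$-invariant subspaces such that: (1) for each $P\in\mathcal P_{\le N}$ and each $k\ge1$, $p\text{-}\lim_{n\in\mathbb N}\bigl(U|_{\mathcal H^{(N)}_k}\bigr)^{P(n)}$ equals $0$ or $Id$; (2) whenever $k\ne l$, there exists $Q\in\mathcal P_{\le N}$ such that $p\text{-}\lim_{n\in\mathbb N}\bigl(U|_{\mathcal H^{(N)}_k}\bigr)^{Q(n)}\neq p\text{-}\lim_{n\in\mathbb N}\bigl(U|_{\mathcal H^{(N)}_l}\bigr)^{Q(n)}$ (that is, one of the two limits is the zero operator and the other is the identity operator on the respective subspace). Furthermore, this decomposition has the following property: (3) for any $k\ge 1$, if $Q\in\mathcal P_{\le N}$ is such that $p\text{-}\lim_{n\in\mathbb N}\bigl(U|_{\mathcal H^{(N)}_k}\bigr)^{sQ(n)}=0$ for each $s\in\mathbb N$, then $p\text{-}\lim_{n\in\mathbb N}\bigl(U|_{\mathcal H^{(N)}_k}\bigr)^{R(n)}=0$ for each $R\in\mathcal P_{\ge \deg Q}$.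
   Context: $\mathbb N=\{1,2,\dots\}$. $\beta\mathbb N$ is the set of ultrafilters on $\mathbb N$, with addition defined by: $A\in p+q$ iff $\{n\in\mathbb N: A-n\in p\}\in q$, where $A-n=\{y\in\mathbb N: y+n\in A\}$. An ultrafilter $p$ is idempotent if $p+p=p$. For a sequence $(x_n)$ in a topological space, $p\text{-}\lim_{n\in\mathbb N}x_n=x$ means that $\{n\in\mathbb N: x_n\in O\}\in p$ for every open neighbourhood $O$ of $x$. For bounded operators on a Hilbert space, $p$-limits are taken in the weak operator topology: $p\text{-}\lim_n W_n=W$ iff $p\text{-}\lim_n\langle W_nf,g\rangle=\langle Wf,g\rangle$ for all vectors $f,g$. Hilbert spaces are complex and separable; $\mathcal U(\mathcal H)$ is the group of unitary operators on $\mathcal H$; a closed subspace $\mathcal J$ is $U$-invariant if $U\mathcal J=\mathcal J$. $\mathcal P$ is the additive group of polynomials $P\in\mathbb Z[x]$ with $P(0)=0$; $\mathcal P_{\le N}$ is the subgroup of those of degree at most $N$ (including the zero polynomial), and $\mathcal P_{\ge N}$ is the set of those of degree at least $N$. *)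

(* Defs.v *)
From HB Require Import structures.
From mathcomp Require Import all_boot all_order all_algebra.
From mathcomp Require Import sesquilinear complex.
From mathcomp Require Import all_classical all_reals all_analysis.

Set Implicit Arguments.
Unset Strict Implicit.
Unset Printing Implicit Defensive.
Import Order.TTheory GRing.Theory Num.Theory.
Import numFieldNormedType.Exports.

Local Open Scope classical_set_scope.
Local Open Scope ring_scope.

Definition posnat : Type := {n : nat | (0 < n)%N}.

Lemma posnat_add_subproof (m n : posnat) : (0 < sval m + sval n)%N.
Proof. by rewrite addn_gt0 (svalP m). Qed.

Definition posnat_add (m n : posnat) : posnat :=
  exist _ (sval m + sval n)%N (posnat_add_subproof m n).

(* The library's [--> l] along a filter asks for all neighbourhoods of l to    *)
(* belong to the image filter, so [x n @[n --> p] --> l] is p-lim x_n = l.     *)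

Definition shift_set (A : set posnat) (n : posnat) : set posnat :=
  [set y | A (posnat_add y n)].

(* The order of p and q is significant: this addition is not commutative.      *)
Definition filter_add (p q : set_system posnat) : set_system posnat :=
  [set A | q [set n | p (shift_set A n)]].

Definition idempotent_ultrafilter (p : set_system posnat) : Prop :=
  UltraFilter p /\ filter_add p p = p.

Definition poly_le (N : nat) : set {poly int} :=
  [set P | P.[0] = 0 /\ (size P <= N.+1)%N].

Definition poly_ge (N : nat) : set {poly int} :=
  [set P | P.[0] = 0 /\ (N < size P)%N].

(* Also 0 for the zero polynomial.                                             *)
Definition poly_deg (P : {poly int}) : nat := (size P).-1.

Definition poly_at (P : {poly int}) (n : posnat) : int := P.[(sval n)%:Z].

Section Hilbert.
Context {R : realType}.

(* R[i] viewed through its numeric-field structure, which is what carries the  *)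
(* topology given by the modulus.                                              *)
Definition Cplx : numClosedFieldType := R[i].

Context {H : completeNormedModType Cplx}.

(* [ip], linear in the first argument and conjugate-linear in the second, is   *)
(* the inner product of the complete norm of H.                                *)
Definition induces_norm (ip : {dot H for (@Num.conj Cplx)}) : Prop :=
  forall f : H, `|f| ^+ 2 = ip f f.

Definition separable_space : Prop := exists D : set H, countable D /\ dense D.

Variable ip : {dot H for (@Num.conj Cplx)}.

Definition unitary_op (U : {linear H -> H}) : Prop :=
  (forall f g, ip (U f) (U g) = ip f g) /\ (forall g, exists f, U f = g).

(* U^m; the partial inverse ['pinv_] is the genuine inverse of a bijective U.  *)
Definition opow (U : H -> H) (m : int) : H -> H :=
  match m with
  | Posz n => iter n U
  | Negz n => iter n.+1 ('pinv_(fun=> 0) [set: H] U)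
  end.

Definition closed_subspace (J : set H) : Prop :=
  [/\ J 0, (forall (a : Cplx) f g, J f -> J g -> J (a *: f + g)) & closed J].

(* Weak operator p-limit, on the Hilbert space J, of the restrictions to J of  *)
(* the W_n; only vectors of J are tested.                                      *)
Definition wot_plim_on (p : set_system posnat) (J : set H)
    (W : posnat -> H -> H) (V : H -> H) : Prop :=
  forall f g, J f -> J g -> ip (W n f) g @[n --> p] --> ip (V f) g.

(* p-lim (U|_J)^(P n) = 0, resp. Id.  If U J = J, then the m-th power of U|_J  *)
(* is the restriction to J of U^m for every integer m, also negative.          *)
Definition plim_pow_zero (p : set_system posnat) (U : H -> H) (J : set H)
    (P : {poly int}) : Prop :=
  wot_plim_on p J (fun n => opow U (poly_at P n)) (fun=> 0).

Definition plim_pow_id (p : set_system posnat) (U : H -> H) (J : set H)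
    (P : {poly int}) : Prop :=
  wot_plim_on p J (fun n => opow U (poly_at P n)) id.

(* {1, ..., K} or {1, 2, ...}; K = 0 gives the empty decomposition of 0.       *)
Definition index_range (I : set nat) : Prop :=
  (exists K : nat, I = [set k | (1 <= k <= K)%N]) \/ I = [set k | (1 <= k)%N].

(* Hilbert sum: the J_k are pairwise orthogonal and every f is the norm limit  *)
(* of a series of vectors f_k of J_k, padded with zeros outside I.             *)
Definition orthogonal_direct_sum (I : set nat) (J : nat -> set H) : Prop :=
  (forall k l, I k -> I l -> k <> l ->
     forall f g, J k f -> J l g -> ip f g = 0) /\
  (forall f : H, exists x : nat -> H,
     [/\ (forall k, I k -> J k (x k)), (forall k, ~ I k -> x k = 0) &
         series x @ \oo --> f]).

Definition invariant_decomposition (U : H -> H) (I : set nat)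
    (J : nat -> set H) : Prop :=
  [/\ index_range I,
      (forall k, I k ->
         [/\ closed_subspace (J k), U @` J k = J k & J k <> [set 0]]) &
      orthogonal_direct_sum I J].

Definition zero_or_id (N : nat) (p : set_system posnat) (U : H -> H)
    (I : set nat) (J : nat -> set H) : Prop :=
  forall P k, poly_le N P -> I k ->
    plim_pow_zero p U (J k) P \/ plim_pow_id p U (J k) P.

Definition distinct_plims (N : nat) (p : set_system posnat) (U : H -> H)
    (I : set nat) (J : nat -> set H) : Prop :=
  forall k l, I k -> I l -> k <> l ->
    exists2 Q, poly_le N Q &
      (plim_pow_zero p U (J k) Q /\ plim_pow_id p U (J l) Q) \/
      (plim_pow_id p U (J k) Q /\ plim_pow_zero p U (J l) Q).

Definition zero_above_degree (N : nat) (p : set_system posnat) (U : H -> H)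
    (I : set nat) (J : nat -> set H) : Prop :=
  forall k Q, I k -> poly_le N Q ->
    (forall s : nat, (1 <= s)%N -> plim_pow_zero p U (J k) (Q *+ s)) ->
    forall P, poly_ge (poly_deg Q) P -> plim_pow_zero p U (J k) P.

Definition same_up_to_reindexing (I : set nat) (J : nat -> set H)
    (I' : set nat) (J' : nat -> set H) : Prop :=
  exists2 s : nat -> nat, set_bij I I' s & forall k, I k -> J k = J' (s k).

End Hilbert.
Arguments Cplx R : clear implicits.
Arguments separable_space {R} H.

(* Main.v *)
Require Import Defs.
From HB Require Import structures.
From mathcomp Require Import all_boot all_order all_algebra.
From mathcomp Require Import sesquilinear complex.
From mathcomp Require Import all_classical all_reals all_analysis.
From mathcomp Require Import ring lra zify.

(** Write [V_P] for the weak limit of [U^(P n)] along [p]. It exists because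
    bounded sequences have weak limits, and the [V_P] are commuting contractions
    with adjoints [V_(-P)], hence normal. If [V_P f = f] then [U^(P n) f] tends to
    [f] in norm, so that [V_(P + Q) f = V_Q f] for all [Q]; in particular the
    polynomials fixing [f] form a group.

    Call [f] homogeneous of level [N] if each [V_P] with [deg P <= N] maps it to [f]
    or to [0]. If these [V_P] are idempotent, every set that is invariant under the
    limits and has a nonzero element has a nonzero homogeneous one, by division
    with remainder on leading coefficients ([homogeneous_subset]); no spectral
    theorem is involved. Idempotence itself follows by induction on the degree
    ([limproj_idempotent]). The difference [P (n + m) - P n - P m] has lower degree,
    so it either fixes or kills a given homogeneous vector [f] for most [m]. In
    the first case the idempotence of [p] turns into [V_P V_P f = V_P f]
    ([limproj_shift]); in the second the correlations of [U^(P n) f] vanish and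
    [V_P f = 0] ([van_der_corput]). Normality of [V_P V_P - V_P] then reduces the
    general vector to homogeneous ones.

    For a set [tau] of polynomials of degree at most [N], let [type_space tau]
    consist of the vectors fixed by [V_P] for [P] in [tau] and killed by the other
    ones. These closed invariant subspaces are pairwise orthogonal by normality;
    at most countably many are nonzero by separability; and they span [H], for
    the complement of their sum is invariant and would contain a homogeneous
    vector. They form the decomposition. In any other one satisfying (1) and (2),
    each summand lies in one type space, and distinct summands in distinct ones;
    since the summands span [H], they are exactly the nonzero type spaces.

    Property (3) rests on [fixed_multiple]: if a polynomial of degree [r] fixes a
    nonzero homogeneous [f], so does one of its differences, of degree [r - 1], and
    inductively some multiple of every polynomial of degree at most [r]. Applied
    to a homogeneous vector fixed by [V_R], with [deg R >= deg Q],
    it provides [s] such that [s Q] fixes that vector. *)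

Set Implicit Arguments.
Unset Strict Implicit.
Unset Printing Implicit Defensive.
Import Order.TTheory GRing.Theory Num.Theory.
Import numFieldNormedType.Exports.

Local Open Scope classical_set_scope.
Local Open Scope ring_scope.

(** * The real inner product underlying a complex one *)

Section RealInnerProduct.
Context {R : realType} {H : completeNormedModType (Cplx R)}.
Variable ip : {dot H for (@Num.conj (Cplx R))}.

(** The real part of the inner product. It induces the same norm, and on complex
    subspaces it has the same orthogonality relation; every limit, projection
    and representation argument below is carried out with it, over [R]. *)
Definition rdot (f g : H) : R := complex.Re (ip f g : R[i]).
Definition rc (r : R) : Cplx R := (r%:C)%C.
Local Notation "'[ f , g ]" := (rdot f g) (at level 0).

Lemma Re_conj (z : Cplx R) : complex.Re (Num.conj z : R[i]) = complex.Re (z : R[i]).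
Proof.
have e : 'Re (Num.conj z) = 'Re z by rewrite Re_conj.
by apply: complexI; rewrite !complexRe.
Qed.

Lemma ReM_rc (r : R) (z : Cplx R) :
  complex.Re (rc r * z : R[i]) = r * complex.Re (z : R[i]).
Proof. by rewrite /rc; case: z => a b /=; rewrite mul0r subr0. Qed.

Lemma rdotDl f g h : '[f + g, h] = '[f, h] + '[g, h].
Proof. by rewrite /rdot linearDl raddfD. Qed.
Lemma rdotC f g : '[f, g] = '[g, f].
Proof. by rewrite /rdot hermC expr0 mul1r Re_conj. Qed.
Lemma rdotDr f g h : '[h, f + g] = '[h, f] + '[h, g].
Proof. by rewrite !(rdotC h) rdotDl. Qed.
Lemma rdotNl f g : '[- f, g] = - '[f, g].
Proof. by rewrite /rdot linearNl raddfN. Qed.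
Lemma rdotNr f g : '[f, - g] = - '[f, g].
Proof. by rewrite !(rdotC f) rdotNl. Qed.
Lemma rdotBl f g h : '[f - g, h] = '[f, h] - '[g, h].
Proof. by rewrite rdotDl rdotNl. Qed.
Lemma rdotBr f g h : '[h, f - g] = '[h, f] - '[h, g].
Proof. by rewrite rdotDr rdotNr. Qed.
Lemma rdot0l f : '[0, f] = 0.
Proof. by rewrite /rdot linear0l. Qed.
Lemma rdot0r f : '[f, 0] = 0.
Proof. by rewrite rdotC rdot0l. Qed.
Lemma rdotZl r f g : '[rc r *: f, g] = r * '[f, g].
Proof. by rewrite /rdot linearZl_LR /= ReM_rc. Qed.
Lemma rdotZr r f g : '[f, rc r *: g] = r * '[f, g].
Proof. by rewrite rdotC rdotZl rdotC. Qed.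

Lemma rdot_adjZ (a : Cplx R) f g : '[a *: f, g] = '[f, Num.conj a *: g].
Proof. by rewrite /rdot linearZl_LR linearZr_LR /= conjCK. Qed.

Lemma rdot_sumr I (r : seq I) (P : pred I) (F : I -> H) f :
  '[f, \sum_(i <- r | P i) F i] = \sum_(i <- r | P i) '[f, F i].
Proof.
by elim/big_rec2: _ => [|i y x _ <-]; rewrite ?rdot0r // rdotDr.
Qed.

(** The imaginary part is itself a value of the real product, at ['i *: g].
    Hence convergence of [ip (x n) g] for all [g] reduces to that of [rdot]. *)
Lemma ip_rdot f g :
  ip f g = ('[f, g] +i* '[f, (complex.Complex 0 1 : Cplx R) *: g])%C.
Proof.
rewrite /rdot linearZr_LR /=.
have -> : Num.conj (complex.Complex 0 1 : Cplx R) =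
    (complex.Complex 0 (-1) : Cplx R).
  by have := conjCi (Cplx R); rewrite -complexiE => ->; rewrite /GRing.opp /= oppr0.
by case: (ip f g) => a b /=; rewrite mul0r mulN1r sub0r opprK.
Qed.

Lemma rdot_eq0_ip f g : (forall a : Cplx R, '[f, a *: g] = 0) -> ip f g = 0.
Proof. by move=> fg0; rewrite ip_rdot fg0 -[g]scale1r fg0. Qed.

Lemma ipff_real f : ip f f = rc '[f, f].
Proof.
have : 0 <= ip f f := dnorm_ge0 ip f.
by rewrite /rdot /rc; case: (ip f f) => a b; rewrite lecE /= => /andP[/eqP-> _].
Qed.

Lemma rdot_ge0 f : 0 <= '[f, f].
Proof. by have := dnorm_ge0 ip f; rewrite ipff_real ler0c. Qed.

Lemma rdot_eq0 f : '[f, f] = 0 -> f = 0.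
Proof. by move=> f0; apply/eqP; rewrite -(dnorm_eq0 ip) ipff_real f0. Qed.

Lemma rdot_gt0 f : f <> 0 -> 0 < '[f, f].
Proof.
move=> f0; rewrite lt_neqAle rdot_ge0 andbT; apply/eqP => /esym /rdot_eq0.
exact: f0.
Qed.

Lemma rdot_inj f g : (forall h, '[f, h] = '[g, h]) -> f = g.
Proof. by move=> e; apply/subr0_eq/rdot_eq0; rewrite rdotBl e subrr. Qed.

Lemma rdot_sqD f g : '[f + g, f + g] = '[f, f] + 2 * '[f, g] + '[g, g].
Proof. rewrite !(rdotDl, rdotDr) (rdotC g f); ring. Qed.

Lemma rdot_sqB f g : '[f - g, f - g] = '[f, f] - 2 * '[f, g] + '[g, g].
Proof. by rewrite rdot_sqD rdotNr rdotNl rdotNr opprK; ring. Qed.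

(** Expands the square of [f - t g]. Leaving [t] free makes it serve both for
    Cauchy-Schwarz and for optimising the van der Corput estimate. *)
Lemma rdot_young f g t : 2 * t * '[f, g] <= '[f, f] + t ^+ 2 * '[g, g].
Proof.
have := rdot_ge0 (f - rc t *: g).
by rewrite rdot_sqB rdotZl !rdotZr; lra.
Qed.

Lemma rdot_cs f g : '[f, g] ^+ 2 <= '[f, f] * '[g, g].
Proof.
have [->|/eqP/rdot_gt0 g0] := eqVneq g 0; first by rewrite !rdot0r expr0n mulr0.
(* This value of t minimises the right-hand side. *)
have := rdot_young f g ('[f, g] / '[g, g]).
set a := '[f, g]; set b := '[g, g] in g0 *; set c := '[f, f] => h.
have : (2 * (a / b) * a) * b <= (c + (a / b) ^+ 2 * b) * b by rewrite ler_pM2r.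
have -> : 2 * (a / b) * a * b = 2 * a ^+ 2 by field; rewrite gt_eqF.
have -> : (c + (a / b) ^+ 2 * b) * b = c * b + a ^+ 2 by field; rewrite gt_eqF.
lra.
Qed.

(** A crude substitute for Cauchy-Schwarz, free of square roots, from which
    boundedness of scalar sequences follows immediately. *)
Lemma rdot_bound f g : `|'[f, g]| <= '[f, f] + '[g, g].
Proof.
have h1 := rdot_young f g 1; have h2 := rdot_young f (- g) 1.
have h3 := rdot_ge0 f; have h4 := rdot_ge0 g.
move: h2; rewrite !(rdotNl, rdotNr) opprK => h2.
rewrite ler_norml; apply/andP; split; lra.
Qed.
End RealInnerProduct.

(** * Completeness and the Riesz representation on closed subspaces *)

Section HilbertTopology.
Context {R : realType} {H : completeNormedModType (Cplx R)}.
Variable ip : {dot H for (@Num.conj (Cplx R))}.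
Hypothesis ip_norm : induces_norm ip.
Local Notation "'[ f , g ]" := (rdot ip f g) (at level 0).

Lemma ltc_rc (x y : R) : (rc x < rc y) = (x < y).
Proof. exact: ltcR. Qed.

Lemma gt0_rc (e : Cplx R) : 0 < e -> exists2 r : R, 0 < r & e = rc r.
Proof.
case: e => a b; rewrite ltcE /= => /andP[/eqP -> a0].
by exists a.
Qed.

Lemma norm_lt_rc (f : H) (r : R) : 0 < r -> (`|f| < rc r) = ('[f, f] < r ^+ 2).
Proof.
move=> r0; have r0' : 0 <= rc r by rewrite ler0c ltW.
rewrite -(ltr_pXn2r (n := 2)) ?nnegrE // ip_norm ipff_real -ltc_rc.
by rewrite /rc rmorphXn.
Qed.

Lemma cvg_rdotP T (F : set_system T) (FF : Filter F) (u : T -> H) (l : H) :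
  u @ F --> l <->
  (forall e : R, 0 < e -> \forall n \near F, '[u n - l, u n - l] < e).
Proof.
split=> [/cvgrPdist_lt ul e e0|ul].
  have s0 : 0 < Num.sqrt e by rewrite sqrtr_gt0.
  have c0 : 0 < rc (Num.sqrt e) by rewrite ltc_rc.
  apply: filterS (ul _ c0) => n.
  by rewrite distrC norm_lt_rc // sqr_sqrtr // ltW.
apply/cvgrPdist_lt => _ /gt0_rc[e e0 ->].
apply: filterS (ul (e ^+ 2) (exprn_gt0 _ e0)) => n.
by rewrite distrC norm_lt_rc.
Qed.

Lemma cvg_rdot T (F : set_system T) (FF : Filter F) (u : T -> H) (l g : H) :
  u @ F --> l -> '[u n, g] @[n --> F] --> '[l, g].
Proof.
move=> /cvg_rdotP ul; apply/cvgrPdist_lt => e e0.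
have h : 0 < e ^+ 2 / ('[g, g] + 1).
  by rewrite divr_gt0 ?exprn_gt0 // ltr_wpDl ?rdot_ge0.
apply: filterS (ul _ h) => n; rewrite ltr_pdivlMr; last first.
  by rewrite ltr_wpDl ?rdot_ge0.
move=> hn; rewrite distrC -rdotBl -(ltr_pXn2r (n := 2)) ?nnegrE ?(ltW e0) //.
rewrite real_normK ?num_real //; apply: le_lt_trans (rdot_cs _ _ _) _.
by apply: le_lt_trans hn; rewrite ler_wpM2l ?rdot_ge0 // lerDl.
Qed.

Lemma rdot_complete (u : nat -> H) :
  (forall e : R, 0 < e -> exists n0, forall m n, (n0 <= m)%N -> (n0 <= n)%N ->
     '[u m - u n, u m - u n] < e) ->
  exists l : H, u @ \oo --> l.
Proof.
move=> uC; suff uc : cvgn u by exists (limn u).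
apply/cauchy_cvgP/cauchy_exP => _ /gt0_rc[e e0 ->].
have [n0 hn0] := uC (e ^+ 2) (exprn_gt0 _ e0).
exists (u n0); exists n0 => // n /= hn.
by rewrite -ball_normE /= norm_lt_rc // hn0.
Qed.

(** Closedness in terms of approximation, so that the topology of [H] can be
    handled through real squared distances only. *)
Lemma closed_rdot (J : set H) : closed J -> forall f : H,
  (forall e : R, 0 < e -> exists2 j, J j & '[f - j, f - j] < e) -> J f.
Proof.
move=> cJ f hf; apply: cJ => B /nbhs_ballP[_ /= /gt0_rc[e e0 ->] eB].
have [j Jj hj] := hf (e ^+ 2) (exprn_gt0 _ e0).
by exists j; split=> //; apply: eB; rewrite -ball_normE /= norm_lt_rc.
Qed.

Lemma rdot_closed (J : set H) : (forall f : H,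
  (forall e : R, 0 < e -> exists2 j, J j & '[f - j, f - j] < e) -> J f) ->
  closed J.
Proof.
move=> hJ f cf; apply: hJ => e e0.
have s0 : 0 < Num.sqrt e by rewrite sqrtr_gt0.
have [|j [Jj]] := cf (ball f (rc (Num.sqrt e))).
  by apply/nbhs_ballP; exists (rc (Num.sqrt e)) => //=; rewrite ltc_rc.
rewrite -ball_normE /= norm_lt_rc // sqr_sqrtr ?ltW // => h.
by exists j.
Qed.

(** The representing vector minimises [|v|^2 - 2 phi v] over [J]: by the
    parallelogram law any minimising sequence is Cauchy, and comparing its limit
    with [v + t g] for all real [t] gives the linear identity. It yields
    both the existence of weak limits ([J] the whole space) and orthogonal
    projections ([phi] the product with a fixed vector). *)
Lemma riesz_closed_subspace (J : set H) (phi : H -> R) (B : R) :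
  0 <= B -> closed_subspace J ->
  (forall f g, J f -> J g -> phi (f + g) = phi f + phi g) ->
  (forall r f, J f -> phi (rc r *: f) = r * phi f) ->
  (forall f, J f -> phi f ^+ 2 <= B * '[f, f]) ->
  exists2 v, J v & forall g, J g -> phi g = '[v, g].
Proof.
move=> B0 [J0 Jlin Jcl] phiD phiZ phiB.
have JD f g : J f -> J g -> J (f + g).
  by move=> Jf Jg; rewrite -[f]scale1r; apply: Jlin.
have JZ a f : J f -> J (a *: f).
  by move=> Jf; rewrite -[_ *: _]addr0; apply: Jlin.
pose E f := '[f, f] - 2 * phi f.
pose S := [set E f | f in J].
have Elb f : J f -> - B <= E f.
  move=> Jf; have := phiB _ Jf; have := rdot_ge0 ip f; rewrite /E.
  set x := '[f, f]; set y := phi f => x0 h.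
  have h1 : (2 * y) ^+ 2 <= (B + x) ^+ 2 by have := sqr_ge0 (B - x); lra.
  have h2 : `|2 * y| <= B + x.
    by rewrite -(ler_pXn2r (n := 2)) ?nnegrE ?addr_ge0 // real_normK ?num_real.
  have := ler_norm (2 * y); lra.
have S0 : S !=set0 by exists (E 0), 0.
have Slb : has_lbound S by exists (- B) => _ [f Jf <-]; exact: Elb.
have Einf f : J f -> inf S <= E f by move=> Jf; apply: ge_inf => //; exists f.
have hv n : exists v, J v /\ E v < inf S + n.+1%:R^-1.
  have n0 : 0 < n.+1%:R^-1 :> R by rewrite invr_gt0 ltr0n.
  have [_ [v Jv <-] ?] := inf_adherent n0 (conj S0 Slb).
  by exists v.
have /choice[v vP] := hv.
(* The midpoint of v m and v n is not below the infimum, so the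
   parallelogram law bounds their distance. *)
have vpar m n : '[v m - v n, v m - v n] <= 2 * m.+1%:R^-1 + 2 * n.+1%:R^-1.
  have [[Jm hm] [Jn hn]] := (vP m, vP n).
  have := Einf _ (JZ (rc 2^-1) _ (JD _ _ Jm Jn)).
  move: hm hn; rewrite /E rdotZl rdotZr phiZ ?phiD //; last exact: JD.
  rewrite rdot_sqB rdot_sqD.
  set a := '[v m, v m]; set b := '[v n, v n]; set c := '[v m, v n].
  move: (m.+1%:R^-1) (n.+1%:R^-1) (phi (v m)) (phi (v n)) (inf S) => x y z t w.
  have h2 : 2 * 2^-1 = 1 :> R by rewrite divff.
  move: (2^-1) h2 => q h2; nra.
have invn (e : R) : 0 < e -> exists n0, forall n, (n0 <= n)%N -> n.+1%:R^-1 < e.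
  move=> e0; exists (Num.trunc e^-1) => n hn.
  rewrite invf_plt ?posrE ?ltr0n //.
  apply: lt_le_trans (truncnS_gt _) _.
  by rewrite ler_nat ltnS.
have [|l vl] := @rdot_complete v.
  move=> e e0; have [|n0 hn0] := invn (e / 4); first by rewrite divr_gt0.
  exists n0 => m n hm hn; apply: le_lt_trans (vpar m n) _.
  have := hn0 _ hm; have := hn0 _ hn.
  by move: (m.+1%:R^-1) (n.+1%:R^-1) => x y; lra.
have Jl : J l.
  apply: closed_rdot => // e e0.
  have /cvg_rdotP/(_ _ e0)[n0 _ hn0] := vl.
  exists (v n0); first by have [] := vP n0.
  by rewrite -opprB rdotNl rdotNr opprK; apply: hn0 => /=.
exists l => // g Jg.
(* Perturbing a near-minimiser by t g costs at most its defect, which tends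
   to 0; a quadratic in t that stays nonnegative has no linear term. *)
have key t : 0 <= 2 * t * ('[l, g] - phi g) + t ^+ 2 * '[g, g].
  have h n : - n.+1%:R^-1 <= 2 * t * ('[v n, g] - phi g) + t ^+ 2 * '[g, g].
    have [Jn hn] := vP n.
    have := Einf _ (JD _ _ Jn (JZ (rc t) _ Jg)); move: hn.
    rewrite /E phiD ?phiZ //; last exact: JZ.
    rewrite rdot_sqD !rdotZr rdotZl.
    move: (n.+1%:R^-1) => x; lra.
  have c1 : 2 * t * ('[v n, g] - phi g) + t ^+ 2 * '[g, g] @[n --> \oo]
      --> 2 * t * ('[l, g] - phi g) + t ^+ 2 * '[g, g].
    apply: cvgD; last exact: cvg_cst.
    apply: cvgM; first exact: cvg_cst.
    by apply: cvgB; [exact: cvg_rdot|exact: cvg_cst].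
  have c2 : - n.+1%:R^-1 @[n --> \oo] --> (0 : R).
    by rewrite -oppr0; apply: cvgN; exact: cvg_harmonic.
  by apply: (ler_cvg_to c2 c1); exact: nearW.
apply/eqP; rewrite eq_sym -subr_eq0; apply/eqP.
move: key; set c := '[l, g] - phi g; have := rdot_ge0 ip g.
set d := '[g, g] => d0 key.
(* The denominator d + 1 stands in for d = |g|^2, which may vanish. *)
have := key (- c / (d + 1)).
have d1 : 0 < d + 1 by lra.
set s := - c / (d + 1).
have -> : c = - s * (d + 1) by rewrite /s; field; rewrite gt_eqF.
move=> h; suff -> : s = 0 by rewrite oppr0 mul0r.
nra.
Qed.

Lemma orthogonal_projection (J : set H) (f : H) : closed_subspace J ->
  exists2 v, J v & forall g, J g -> '[f - v, g] = 0.
Proof.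
move=> cJ.
have [||||v Jv hv] := @riesz_closed_subspace J (rdot ip f) '[f, f] _ cJ.
- exact: rdot_ge0.
- by move=> *; rewrite rdotDr.
- by move=> *; rewrite rdotZr.
- by move=> *; rewrite rdot_cs.
by exists v => // g Jg; rewrite rdotBl hv // subrr.
Qed.

End HilbertTopology.

(** * Limits of bounded sequences along an ultrafilter *)

Section UltrafilterLimits.
Context {R : realType} (p : set_system posnat) {pU : UltraFilter p}.

Lemma cvg_le T (F : set_system T) {FF : ProperFilter F} (a b : T -> R) (l l' : R) :
  a @ F --> l -> b @ F --> l' -> (\forall n \near F, a n <= b n) -> l <= l'.
Proof.
move=> al bl ab; rewrite leNgt; apply/negP => ll'.
have ll0 : 0 < l - l' by rewrite subr_gt0.
have h : \forall n \near F, 0 < a n - b n by apply: cvgr_gt ll0; exact: cvgB.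
by have [n []] := filter_ex (filterI h ab); rewrite /= subr_gt0 ltNge => /negP.
Qed.

Definition bounded_seq (a : posnat -> R) := exists C : R, forall n, `|a n| <= C.

Definition plim (a : posnat -> R) : R := lim (a @ p).

(** The image of an ultrafilter is an ultrafilter, and a closed bounded interval
    is compact. *)
Lemma plim_cvg (a : posnat -> R) : bounded_seq a -> a @ p --> plim a.
Proof.
move=> [C aC]; suff [l al] : exists l : R, a @ p --> l.
  by rewrite /plim (cvg_lim _ al).
have := @segment_compact R (- C) C; rewrite compact_ultra => /(_ (a @ p)).
have aU : UltraFilter (a @ p).
  split=> [|G GP ap]; first exact: fmap_proper_filter.
  apply/seteqP; split=> // A GA; rewrite /fmap /=.
  have [//|pA] := in_ultra_setVsetC (a @^-1` A) pU.
  have GA' : G (~` A) by apply: ap; rewrite /fmap /= preimage_setC.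
  by have [x [Ax /(_ Ax)]] := filter_ex (filterI GA GA').
have apC : (a @ p) `[- C, C]%classic.
  by apply: nearW => n /=; rewrite in_itv /= -ler_norml.
by move=> /(_ aU apC)[l [_ al]]; exists l.
Qed.

Lemma plimE (a : posnat -> R) (l : R) : a @ p --> l -> plim a = l.
Proof. by move=> al; apply: cvg_lim. Qed.

Lemma plim_norm_le (a : posnat -> R) C : (forall n, `|a n| <= C) -> `|plim a| <= C.
Proof.
move=> aC; have ca : a @ p --> plim a by apply: plim_cvg; exists C.
apply: (cvg_le (cvg_norm ca) (cvg_cst C)).
exact: nearW.
Qed.

(** How idempotence of [p] enters: a limit along [p] equals the iterated limit of
    the shifted sequence. The addition of ultrafilters is read off the
    definition: for most [m], most [n] put [n + m] in a given set of [p]. *)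
Lemma plim_idem (a : posnat -> R) : filter_add p p = p -> bounded_seq a ->
  plim (fun n => a (posnat_add n m)) @[m --> p] --> plim a.
Proof.
move=> pp ab; apply/cvgrPdist_le => e e0.
have /cvgrPdist_lt/(_ _ e0) := plim_cvg ab.
rewrite /prop_near1 /nbhs /= -{1}pp /filter_add /=.
apply: filterS => m pm.
have cm : a (posnat_add n m) @[n --> p] --> plim (fun n => a (posnat_add n m)).
  by apply: plim_cvg; have [C aC] := ab; exists C.
apply: (cvg_le (cvg_norm (cvgB (cvg_cst (plim a)) cm)) (cvg_cst e)).
by apply: filterS pm => n; rewrite /shift_set /=; exact: ltW.
Qed.

Lemma posnat_addA (m n k : posnat) :
  posnat_add (posnat_add m n) k = posnat_add m (posnat_add n k).
Proof. by apply: val_inj; rewrite /= addnA. Qed.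

End UltrafilterLimits.

(** * Weak limits and the van der Corput lemma *)

Section WeakLimits.
Context {R : realType} {H : completeNormedModType (Cplx R)}.
Variable ip : {dot H for (@Num.conj (Cplx R))}.
Hypothesis ip_norm : induces_norm ip.
Context (p : set_system posnat) {pU : UltraFilter p}.
Local Notation "'[ f , g ]" := (rdot ip f g) (at level 0).

Definition bounded_vec (x : posnat -> H) :=
  exists C : R, forall n, '[x n, x n] <= C.

(** The weak limit as a total function, [0] when there is none. *)
Definition wlim (x : posnat -> H) : H :=
  xget 0 [set v | forall g, '[x n, g] @[n --> p] --> '[v, g]].

Lemma bounded_rdot (x y : posnat -> H) :
  bounded_vec x -> bounded_vec y -> bounded_seq (fun n => '[x n, y n]).
Proof.
move=> [C xC] [D yD]; exists (C + D) => n.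
by apply: le_trans (rdot_bound _ _ _) _; apply: lerD.
Qed.

Lemma bounded_cst (g : H) : bounded_vec (fun=> g).
Proof. by exists '[g, g]. Qed.

Lemma bounded_vecD (x y : posnat -> H) :
  bounded_vec x -> bounded_vec y -> bounded_vec (fun n => x n + y n).
Proof.
move=> [C xC] [D yD]; exists (2 * C + 2 * D) => n.
have := rdot_ge0 ip (x n - y n); rewrite rdot_sqB rdot_sqD.
by have := xC n; have := yD n; lra.
Qed.

Lemma bounded_shift (x : posnat -> H) m :
  bounded_vec x -> bounded_vec (fun n => x (posnat_add n m)).
Proof. by move=> [C xC]; exists C. Qed.

Lemma wlimP (x : posnat -> H) (g : H) : bounded_vec x ->
  '[x n, g] @[n --> p] --> '[wlim x, g].
Proof.
move=> xb; move: g; rewrite /wlim; case: xgetP => [v _ //|nov].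
have cx g : '[x n, g] @[n --> p] --> plim p (fun n => '[x n, g]).
  by apply: plim_cvg; apply: bounded_rdot => //; exact: bounded_cst.
have [C xC] := xb.
have C0 : 0 <= `|C| by [].
have [|f g _ _|r f _|f _|v _ hv] := @riesz_closed_subspace _ _ _ ip_norm setT
    (fun g => plim p (fun n => '[x n, g])) `|C| C0.
- by split => //; exact: closedT.
- apply: plimE; under eq_cvg do rewrite rdotDr; exact: cvgD.
- apply: plimE; under eq_cvg do rewrite rdotZr.
  by apply: cvgM => //; exact: cvg_cst.
- apply: (cvg_le (cvgM (cx f) (cx f)) (cvg_cst (`|C| * '[f, f]))).
  apply: nearW => n /=; rewrite -expr2; apply: le_trans (rdot_cs _ _ _) _.
  by rewrite ler_wpM2r ?rdot_ge0 // (le_trans (xC n)) // ler_norm.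
by exfalso; apply: (nov v) => g; rewrite -hv.
Qed.

Lemma wlim_eq (x : posnat -> H) v :
  (forall g, '[x n, g] @[n --> p] --> '[v, g]) -> wlim x = v.
Proof.
move=> xv; apply: (rdot_inj (ip := ip)) => g.
rewrite /wlim; case: xgetP => [w _ xw|/(_ v)//].
exact: cvg_unique (xw g) (xv g).
Qed.

Hypothesis pp : filter_add p p = p.

(** Van der Corput along an idempotent ultrafilter. Let [v] be the weak limit and
    [c = |v|^2]. By induction on [k] there is a sum [Y] of [k] shifts of [x], each
    with weak limit close to [v] and with small product with the sum of those
    added before it: so [<Y, v>] grows like [k c] and [|Y|^2] only like [k], which
    forces [c = 0]. To pass from [k] to [k + 1], shift [Y] by a common [m] and add
    [x]; by idempotence, the limits of the shifted quantities tend along [m] to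
    the unshifted ones, so for most [m] no strict inequality is lost. *)
Lemma van_der_corput (x : posnat -> H) : bounded_vec x ->
  (\forall m \near p, '[x (posnat_add n m), x n] @[n --> p] --> (0 : R)) ->
  wlim x = 0.
Proof.
move=> xb x0; set v := wlim x; pose c := '[v, v].
have [B xB] := xb.
(* The additive slack 1 is met strictly by Y = 0, and strict inequalities survive
   the choice of m. The third one bounds the correlation of a shift of Y with x. *)
have step (k : nat) : exists Y, [/\ bounded_vec Y,
    k%:R * c - 1 < plim p (fun n => '[Y n, v]),
    plim p (fun n => '[Y n, Y n]) < k%:R * (B + 2) + 1 &
    plim p (fun m => plim p (fun n => '[Y (posnat_add n m), x n])) < 1].
  elim: k => [|k [Y [Yb Y1 Y2 Y3]]].
    have e0 : plim p (fun=> 0 : R) = 0 by apply: plimE; exact: cvg_cst.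
    exists (fun=> 0); split.
    - exact: bounded_cst.
    - by under eq_fun do rewrite rdot0l; rewrite e0; lra.
    - by under eq_fun do rewrite rdot0l; rewrite e0; lra.
    - under eq_fun do (under eq_fun do rewrite rdot0l).
      by rewrite e0 e0.
  pose b m := plim p (fun n => '[Y (posnat_add n m), x n]).
  have bb : bounded_seq b.
    have [D YD] := Yb; exists (D + B) => m; apply: plim_norm_le => n.
    by apply: le_trans (rdot_bound _ _ _) _; apply: lerD.
  have h1 : \forall m \near p,
      k%:R * c - 1 < plim p (fun n => '[Y (posnat_add n m), v]).
    by apply: cvgr_gt Y1; exact: (plim_idem pp (bounded_rdot Yb (bounded_cst v))).
  have h2 : \forall m \near p,
      plim p (fun n => '[Y (posnat_add n m), Y (posnat_add n m)]) <
      k%:R * (B + 2) + 1.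
    by apply: cvgr_lt Y2; exact: (plim_idem pp (bounded_rdot Yb Yb)).
  have h3 : \forall m \near p, b m < 1.
    by apply: cvgr_lt Y3; exact: plim_cvg.
  have h4 : \forall m \near p, plim p (fun m' => b (posnat_add m' m)) < 1.
    by apply: cvgr_lt Y3; exact: plim_idem.
  have [m [[m1 m2] [m3 m4]]] :=
    filter_ex (filterI (filterI h1 h2) (filterI h3 h4)).
  pose Ym n := Y (posnat_add n m).
  have Ymb : bounded_vec Ym by exact: bounded_shift.
  have cyv := @plim_cvg R p pU _ (bounded_rdot Ymb (bounded_cst v)).
  have cyy := @plim_cvg R p pU _ (bounded_rdot Ymb Ymb).
  have cyx := @plim_cvg R p pU _ (bounded_rdot Ymb xb).
  exists (fun n => x n + Ym n); split.
  - exact: bounded_vecD.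
  - have -> : plim p (fun n => '[x n + Ym n, v]) = c + plim p (fun n => '[Ym n, v]).
      apply: plimE; under eq_cvg do rewrite rdotDl.
      by apply: cvgD; [exact: wlimP|exact: cyv].
    by move: m1; rewrite -natr1 mulrDl mul1r /Ym; lra.
  - have cxx := @plim_cvg R p pU _ (bounded_rdot xb xb).
    have -> : plim p (fun n => '[x n + Ym n, x n + Ym n]) =
        plim p (fun n => '[x n, x n]) + 2 * plim p (fun n => '[Ym n, x n]) +
        plim p (fun n => '[Ym n, Ym n]).
      apply: plimE; under eq_cvg do rewrite rdot_sqD.
      apply: cvgD; last exact: cyy.
      apply: cvgD; first exact: cxx.
      by apply: cvgM; [exact: cvg_cst|under eq_cvg do rewrite rdotC].
    have : plim p (fun n => '[x n, x n]) <= B.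
      by apply: (cvg_le cxx (cvg_cst B)); exact: nearW.
    by move: m2 m3; rewrite -natr1 mulrDl mul1r /b -/(Ym _); lra.
  - rewrite (_ : plim _ _ = plim p (fun m' => b (posnat_add m' m))) //.
    apply: plimE; rewrite -[plim _ _]add0r.
    have cb : b (posnat_add m' m) @[m' --> p] -->
        plim p (fun m' => b (posnat_add m' m)).
      by apply: plim_cvg; have [D bD] := bb; exists D.
    apply: (cvg_trans _ (cvgD (cvg_cst 0) cb)).
    apply: near_eq_cvg; apply: filterS x0 => m' x0; rewrite fctE add0r.
    rewrite -[LHS]add0r; apply/esym/plimE.
    under eq_cvg do rewrite rdotDl.
    apply: cvgD => //.
    under eq_cvg do rewrite /Ym posnat_addA.
    by apply: plim_cvg; apply: bounded_rdot => //; exact: bounded_shift.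
(* The parameter k in Young's inequality is of the right order, as <Y, v> is
   about k times |v|^2. *)
have ineq (k : nat) : k%:R ^+ 2 * c <= k%:R * (B + 4) + 1.
  have [Y [Yb Y1 Y2 _]] := step k.
  have cyv := @plim_cvg R p pU _ (bounded_rdot Yb (bounded_cst v)).
  have cyy := @plim_cvg R p pU _ (bounded_rdot Yb Yb).
  have : 2 * k%:R * plim p (fun n => '[Y n, v]) <=
      plim p (fun n => '[Y n, Y n]) + k%:R ^+ 2 * c.
    have c1 : 2 * k%:R * '[Y n, v] @[n --> p] -->
        2 * k%:R * plim p (fun n => '[Y n, v]).
      by apply: cvgM; [exact: cvg_cst|exact: cyv].
    have c2 : '[Y n, Y n] + k%:R ^+ 2 * c @[n --> p] -->
        plim p (fun n => '[Y n, Y n]) + k%:R ^+ 2 * c.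
      by apply: cvgD; [exact: cyy|exact: cvg_cst].
    by apply: (cvg_le c1 c2); apply: nearW => n; exact: rdot_young.
  have : k%:R * (k%:R * c - 1) <= k%:R * plim p (fun n => '[Y n, v]).
    by rewrite ler_wpM2l // ltW.
  move: Y2; set s := plim _ _; set t := plim _ _.
  move: (k%:R : R) => q; lra.
apply: (rdot_eq0 (ip := ip)); apply/eqP; rewrite eq_le rdot_ge0 andbT -/c.
rewrite leNgt; apply/negP => c0.
have B0 : 0 <= B.
  have [n _] := @filter_ex _ p _ setT filterT.
  exact: le_trans (rdot_ge0 _ _) (xB n).
have [k hk] : exists k : nat, (B + 5) / c < k.+1%:R.
  by exists (Num.trunc ((B + 5) / c)); exact: truncnS_gt.
have := ineq k.+1; move: hk; rewrite ltr_pdivrMr // => hk.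
have k1 : 1 <= k.+1%:R :> R by rewrite ler1n.
move: (k.+1%:R) k1 hk => q q1 hq; rewrite leNgt => /negP; apply.
nra.
Qed.

End WeakLimits.

(** * The weak limits of polynomial powers of a unitary operator *)

Section PowerLimits.
Context {R : realType} {H : completeNormedModType (Cplx R)}.
Variable ip : {dot H for (@Num.conj (Cplx R))}.
Hypothesis ip_norm : induces_norm ip.
Variable U : {linear H -> H}.
Hypothesis U_unitary : unitary_op ip U.
Local Notation "'[ f , g ]" := (rdot ip f g) (at level 0).
Local Notation Uinv := ('pinv_(fun=> 0) [set: H] U).

(** An isometry is injective, so the partial inverse used for the negative powers
    is a two-sided inverse. *)
Lemma unitaryK : cancel U Uinv.
Proof.
move=> f; rewrite pinvKV ?inE // => {}f g _ _ fg.
apply: (rdot_inj (ip := ip)) => h.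
by rewrite /rdot -(U_unitary.1 f) fg (U_unitary.1 g).
Qed.

Lemma unitaryVK : cancel Uinv U.
Proof.
move=> f; rewrite pinvK // inE.
by have [g <-] := U_unitary.2 f; exists g.
Qed.

Lemma opowS m f : opow U (m + 1) f = U (opow U m f).
Proof.
case: m => [n|[|n]].
- by have -> : Posz n + 1 = Posz n.+1 by rewrite -addn1 PoszD.
- by have -> /= : Negz 0 + 1 = 0 by []; rewrite unitaryVK.
- have -> /= : Negz n.+1 + 1 = Negz n by rewrite !NegzE; lia.
  by rewrite unitaryVK.
Qed.

Lemma opowD m n f : opow U (m + n) f = opow U m (opow U n f).
Proof.
elim/int_ind: m => [|m IH|m IH]; first by rewrite add0r.
- by rewrite -addn1 PoszD addrAC !opowS IH.
- apply: (can_inj unitaryK); rewrite -!opowS addrAC -addn1 PoszD opprD addrNK.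
  exact: IH.
Qed.

Lemma opowNK m f : opow U m (opow U (- m) f) = f.
Proof. by rewrite -opowD subrr. Qed.

Lemma opow_lin m a f g : opow U m (a *: f + g) = a *: opow U m f + opow U m g.
Proof.
elim/int_ind: m => [//|m IH|m IH].
- by rewrite -addn1 PoszD !opowS IH linearP.
- apply: (can_inj unitaryK).
  by rewrite linearP -!opowS -addn1 PoszD opprD addrNK IH.
Qed.

Lemma rdot_opow m f g : '[opow U m f, opow U m g] = '[f, g].
Proof.
have rU h k : '[U h, U k] = '[h, k] by rewrite /rdot U_unitary.1.
elim/int_ind: m => [//|m IH|m IH].
- by rewrite -addn1 PoszD !opowS rU IH.
- by rewrite -rU -!opowS -addn1 PoszD opprD addrNK IH.
Qed.

Lemma rdot_opow_adj m f g : '[opow U m f, g] = '[f, opow U (- m) g].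
Proof. by rewrite -[in LHS](opowNK m g) rdot_opow. Qed.

Context (p : set_system posnat) {pU : UltraFilter p}.

(** The weak limit of [U^(P n)], which turns out to be an orthogonal projection
    (see [limproj_idempotent] and [limproj_contr]). *)
Definition limproj (P : {poly int}) (f : H) : H :=
  wlim ip p (fun n => opow U (poly_at P n) f).
Local Notation V := limproj.

Lemma bounded_opow P f : bounded_vec ip (fun n => opow U (poly_at P n) f).
Proof. by exists '[f, f] => n; rewrite rdot_opow. Qed.

Lemma limproj_cvg P f g : '[opow U (poly_at P n) f, g] @[n --> p] --> '[V P f, g].
Proof. by apply: wlimP => //; exact: bounded_opow. Qed.

Lemma limproj_eq P f v :
  (forall g, '[opow U (poly_at P n) f, g] @[n --> p] --> '[v, g]) -> V P f = v.
Proof. exact: wlim_eq. Qed.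

(** A complex scalar moves to the other side of [rdot] as its conjugate, so the
    real product suffices to prove complex linearity. *)
Lemma limproj_lin P a f g : V P (a *: f + g) = a *: V P f + V P g.
Proof.
apply: limproj_eq => h; under eq_cvg do rewrite opow_lin rdotDl rdot_adjZ.
by rewrite rdotDl rdot_adjZ; apply: cvgD; exact: limproj_cvg.
Qed.

Lemma limprojD P f g : V P (f + g) = V P f + V P g.
Proof. by rewrite -[f]scale1r limproj_lin !scale1r. Qed.

Lemma limproj0r P : V P 0 = 0.
Proof.
have /eqP := limprojD P 0 0.
by rewrite addr0 -subr_eq0 opprD addNKr oppr_eq0 => /eqP.
Qed.

Lemma limprojN P f : V P (- f) = - V P f.
Proof.
by rewrite -scaleN1r -[_ *: _]addr0 limproj_lin limproj0r addr0 scaleN1r.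
Qed.

Lemma limprojB P f g : V P (f - g) = V P f - V P g.
Proof. by rewrite limprojD limprojN. Qed.

Lemma poly_atD P Q n : poly_at (P + Q) n = poly_at P n + poly_at Q n.
Proof. by rewrite /poly_at hornerD. Qed.

Lemma poly_atN P n : poly_at (- P) n = - poly_at P n.
Proof. by rewrite /poly_at hornerN. Qed.

Lemma limproj_opow P m f : V P (opow U m f) = opow U m (V P f).
Proof.
apply: limproj_eq => g; rewrite rdot_opow_adj.
under eq_cvg do rewrite -opowD addrC opowD rdot_opow_adj.
exact: limproj_cvg.
Qed.

(** The adjoint of the limit for [P] is the limit for [- P]; with
    [limprojC] this makes every limit operator normal. *)
Lemma limproj_adj P f g : '[V P f, g] = '[f, V (- P) g].
Proof.
have c1 := @limproj_cvg P f g.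
have c2 : '[opow U (poly_at P n) f, g] @[n --> p] --> '[f, V (- P) g].
  under eq_cvg do rewrite rdot_opow_adj rdotC -poly_atN.
  by rewrite rdotC; exact: limproj_cvg.
exact: cvg_unique c1 c2.
Qed.

Lemma limprojC P Q f : V P (V Q f) = V Q (V P f).
Proof.
apply: limproj_eq => g; under eq_cvg do rewrite -limproj_opow limproj_adj.
by rewrite limproj_adj; exact: limproj_cvg.
Qed.

Lemma limproj0 f : V 0 f = f.
Proof.
apply: limproj_eq => g; under eq_cvg do rewrite /poly_at horner0 /=.
exact: cvg_cst.
Qed.

Lemma limproj_contr P f : '[V P f, V P f] <= '[f, f].
Proof.
have c := @limproj_cvg P f (V P f).
have : '[V P f, V P f] <= ('[f, f] + '[V P f, V P f]) / 2.
  apply: (cvg_le c (cvg_cst _)); apply: nearW => n.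
  have := rdot_young ip (opow U (poly_at P n) f) (V P f) 1.
  by rewrite rdot_opow; lra.
by lra.
Qed.

(** Normality: the limits for [P] and [- P] are adjoint and commute. *)
Lemma limproj_normN P f : '[V (- P) f, V (- P) f] = '[V P f, V P f].
Proof. by rewrite limproj_adj opprK limprojC -limproj_adj. Qed.

Lemma limproj_fixN P f : V P f = f -> V (- P) f = f.
Proof.
move=> Pf; apply/eqP; rewrite -subr_eq0; apply/eqP/(rdot_eq0 (ip := ip)).
by rewrite rdot_sqB limproj_normN Pf [X in 2 * X]rdotC -limproj_adj Pf; ring.
Qed.

(** All the [U^(P n) f] have norm [|f|], so weak convergence to [f] is
    norm convergence. *)
Lemma limproj_fix_strong P f : V P f = f ->
  '[opow U (poly_at P n) f - f, opow U (poly_at P n) f - f] @[n --> p] --> (0 : R).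
Proof.
move=> Pf; under eq_cvg do rewrite rdot_sqB rdot_opow.
have c : '[f, f] - 2 * '[opow U (poly_at P n) f, f] + '[f, f] @[n --> p] -->
    '[f, f] - 2 * '[V P f, f] + '[f, f].
  apply: cvgD; last exact: cvg_cst.
  apply: cvgB; first exact: cvg_cst.
  by apply: cvgM; [exact: cvg_cst|exact: limproj_cvg].
by move: c; rewrite Pf (_ : _ - _ + _ = 0) //; ring.
Qed.

(** Norm convergence [U^(P n) f -> f] allows the factor [U^(P n)] to be removed
    under any further unitary factor. It follows that the polynomials fixing
    a given vector form a group. *)
Lemma limproj_fixDl P Q f : V P f = f -> V (P + Q) f = V Q f.
Proof.
move=> Pf; apply: limproj_eq => g.
pose d n := opow U (poly_at P n) f - f.
(* Cauchy-Schwarz: d n tends to 0 in norm, the other factor has norm |g|. *)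
have e0 : '[d n, opow U (- poly_at Q n) g] @[n --> p] --> (0 : R).
  apply/cvgrPdist_lt => e e0.
  have h : 0 < e ^+ 2 / ('[g, g] + 1).
    by rewrite divr_gt0 ?exprn_gt0 // ltr_wpDl ?rdot_ge0.
  have := limproj_fix_strong Pf => /cvgr_lt/(_ _ h); apply: filterS => n.
  rewrite -/(d n) ltr_pdivlMr; last by rewrite ltr_wpDl ?rdot_ge0.
  move=> hn; rewrite sub0r normrN -(ltr_pXn2r (n := 2)) ?nnegrE ?(ltW e0) //.
  rewrite real_normK ?num_real //; apply: le_lt_trans (rdot_cs _ _ _) _.
  rewrite rdot_opow; apply: le_lt_trans hn.
  by rewrite ler_wpM2l ?rdot_ge0 // lerDl.
have c := cvgD (@limproj_cvg Q f g) e0; rewrite addr0 in c.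
suff -> : (fun n => '[opow U (poly_at (P + Q) n) f, g]) =
    (fun n => '[opow U (poly_at Q n) f, g] + '[d n, opow U (- poly_at Q n) g])
  by exact: c.
apply/funext => n; rewrite -rdot_opow_adj /d.
have -> : opow U (poly_at Q n) (opow U (poly_at P n) f - f) =
    opow U (poly_at (P + Q) n) f - opow U (poly_at Q n) f.
  rewrite addrC -scaleN1r opow_lin scaleN1r addrC poly_atD.
  by rewrite [_ + poly_at Q n]addrC opowD.
by rewrite rdotBl addrCA subrr addr0.
Qed.

Lemma limproj_fixMn P f s : V P f = f -> V (P *+ s) f = f.
Proof.
by move=> Pf; elim: s => [|s IH]; rewrite ?mulr0n ?limproj0 // mulrS limproj_fixDl.
Qed.

Lemma limproj_fixMz P f (s : int) : V P f = f -> V (P *~ s) f = f.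
Proof.
by move=> Pf; case: s => s; [exact: limproj_fixMn|apply/limproj_fixN/limproj_fixMn].
Qed.

(** As a polynomial in [n], this is [P (n + m) - P n - P m]: the discrete derivative
    of [P], normalised so as to vanish at [0] when [P] does. *)
Definition poly_diff (P : {poly int}) (m : posnat) : {poly int} :=
  P \Po ('X + (sval m)%:Z%:P) - P - (poly_at P m)%:P.

Lemma poly_diffE P n m :
  poly_at P (posnat_add n m) = poly_at P m + poly_at (P + poly_diff P m) n.
Proof.
rewrite /poly_diff addrA addrCA subrr addr0 /poly_at.
rewrite hornerD hornerN hornerC horner_comp hornerD hornerX hornerC.
by rewrite addrCA subrr addr0 PoszD.
Qed.

Hypothesis pp : filter_add p p = p.

(** Idempotence of [p] applied to [<U^(P n) f, g>]: replacing [n] by [n + m]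
    produces the difference polynomial, of lower degree than [P]. *)
Lemma limproj_shift P f g :
  '[V (P + poly_diff P m) f, opow U (- poly_at P m) g] @[m --> p] --> '[V P f, g].
Proof.
have h := plim_idem pp (bounded_rdot (bounded_opow P f) (bounded_cst ip g)).
rewrite (plimE (@limproj_cvg P f g)) in h.
suff <- : (fun m => plim p
      (fun n => '[opow U (poly_at P (posnat_add n m)) f, g])) =
    (fun m => '[V (P + poly_diff P m) f, opow U (- poly_at P m) g]) by exact: h.
apply/funext => m; apply: plimE.
under eq_cvg do rewrite poly_diffE opowD rdot_opow_adj.
exact: limproj_cvg.
Qed.

End PowerLimits.

(** * Differences of integer polynomials *)

Section PolynomialDifference.

Lemma coef_XaddC_exp (c : int) n k :
  (('X + c%:P) ^+ n)`_k = c ^+ (n - k) *+ 'C(n, k).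
Proof.
rewrite addrC exprDn.
have -> : \sum_(i < n.+1) c%:P ^+ (n - i) * 'X ^+ i *+ 'C(n, i) =
    \poly_(i < n.+1) (c ^+ (n - i) *+ 'C(n, i)) :> {poly int}.
  rewrite poly_def; apply: eq_bigr => i _.
  by rewrite -polyC_exp mul_polyC scalerMnl.
rewrite coef_poly ltnS; case: leqP => // nk.
by rewrite bin_small.
Qed.

Lemma poly_le_sub (P Q : {poly int}) N :
  poly_le N P -> poly_le N Q -> poly_le N (P - Q).
Proof.
move=> [P0 Ps] [Q0 Qs]; split; first by rewrite hornerD hornerN P0 Q0 subrr.
by apply: leq_trans (size_polyD _ _) _; rewrite size_polyN geq_max Ps.
Qed.

Lemma poly_leN (P : {poly int}) N : poly_le N P -> poly_le N (- P).
Proof. by move=> [P0 Ps]; split; rewrite ?size_polyN // hornerN P0 oppr0. Qed.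

Lemma poly_leMz (P : {poly int}) N s : poly_le N P -> poly_le N (P *~ s).
Proof.
have h n : poly_le N P -> poly_le N (P *+ n).
  move=> [P0 Ps]; split; first by rewrite hornerMn P0 mul0rn.
  apply/leq_sizeP => j Nj; rewrite coefMn.
  by move/leq_sizeP: Ps => ->; rewrite ?mul0rn.
by case: s => n Pn; [exact: h|apply/poly_leN/h].
Qed.

Lemma poly_le0 (P : {poly int}) : poly_le 0 P -> P = 0.
Proof.
by move=> [P0 /size1_polyC e]; move: P0; rewrite e hornerC => ->.
Qed.

Lemma poly_le_coef0 (P : {poly int}) d :
  poly_le d.+1 P -> P`_d.+1 = 0 -> poly_le d P.
Proof.
move=> [P0 Ps] Pd; split=> //; apply/leq_sizeP => j.
by rewrite leq_eqVlt => /predU1P[<-//|dj]; move/leq_sizeP: Ps; apply.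
Qed.

Lemma poly_leW (P : {poly int}) d N : (d <= N)%N -> poly_le d P -> poly_le N P.
Proof. by move=> dN [P0 Ps]; split=> //; apply: leq_trans Ps _. Qed.

(** The leading terms of [P (n + m)] and [P n] cancel. *)
Lemma poly_diff_le (P : {poly int}) m d :
  poly_le d.+1 P -> poly_le d (poly_diff P m).
Proof.
move=> [P0 Ps]; split.
  rewrite /poly_diff !hornerD !hornerN hornerC horner_comp hornerD hornerX hornerC.
  by rewrite P0 add0r subr0 subrr.
apply/leq_sizeP => j dj; rewrite /poly_diff !coefB coefC.
have -> : (j == 0)%N = false by case: j dj.
rewrite subr0.
rewrite coef_comp_poly; under eq_bigr do rewrite coef_XaddC_exp.
apply/eqP; rewrite subr_eq0; apply/eqP.
have [jP|Pj] := ltnP j (size P); last first.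
  rewrite nth_default // big1 // => i _.
  by rewrite bin_small ?mulr0 //; apply: leq_trans Pj.
have sP : size P = j.+1.
  by apply/eqP; rewrite eqn_leq jP andbT; apply: leq_trans Ps _.
rewrite sP big_ord_recr /= binn subnn expr0 mulr1 big1 ?add0r // => i _.
by rewrite bin_small ?mulr0.
Qed.

Lemma poly_diff_lead (P : {poly int}) m d :
  size P = d.+3 -> (poly_diff P m)`_d.+1 = P`_d.+2 * (sval m)%:Z *+ d.+2.
Proof.
move=> sP; rewrite /poly_diff !coefB coefC subr0.
rewrite coef_comp_poly; under eq_bigr do rewrite coef_XaddC_exp.
rewrite sP 2!big_ord_recr /= big1 ?add0r => [|i _]; last first.
  by rewrite bin_small ?mulr0.
rewrite subnn binn expr0 mulr1 subSnn expr1 addrAC subrr add0r.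
by rewrite binSn mulrnAr.
Qed.

(** As [m] is nonzero, exactly one degree is lost, because the next coefficient is
    [deg P * m] times the leading one. Degree one is excluded: there the difference
    is zero. *)
Lemma poly_diff_size (P : {poly int}) m d :
  poly_le d.+2 P -> size P = d.+3 -> size (poly_diff P m) = d.+2.
Proof.
move=> Ple sP; apply/eqP; rewrite eqn_leq; apply/andP; split.
  by have [] := poly_diff_le m Ple.
rewrite ltnNge; apply/negP => /leq_sizeP/(_ d.+1 (leqnn _)).
rewrite poly_diff_lead // => /eqP; rewrite mulrn_eq0 mulf_eq0 /=.
have /negPf -> : P`_d.+2 != 0.
  have : lead_coef P != 0 by rewrite lead_coef_eq0 -size_poly_eq0 sP.
  by rewrite lead_coefE sP.
by have := svalP m; case: (sval m).
Qed.

End PolynomialDifference.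

(** * Homogeneous vectors and idempotence of the limits *)

Section Homogeneous.
Context {R : realType} {H : completeNormedModType (Cplx R)}.
Variable ip : {dot H for (@Num.conj (Cplx R))}.
Hypothesis ip_norm : induces_norm ip.
Variable U : {linear H -> H}.
Hypothesis U_unitary : unitary_op ip U.
Context (p : set_system posnat) {pU : UltraFilter p}.
Hypothesis pp : filter_add p p = p.
Local Notation "'[ f , g ]" := (rdot ip f g) (at level 0).
Local Notation V := (limproj ip U p).

Definition limproj_invariant (K : set H) := forall P f, K f -> K (V P f).

(** Vectors on which the limits behave as on one component of the
    decomposition. *)
Definition homogeneous N f := forall P, poly_le N P -> V P f = f \/ V P f = 0.

Definition idempotent_upto (d : nat) :=
  forall P f, poly_le d P -> V P (V P f) = V P f.

(** Commuting projections need not have common eigenvectors; here they do,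
    because the fixing polynomials form a group of finite rank. Induct
    on the degree bound. At degree [d + 1] choose [Q] with the least positive
    leading coefficient [a] among those whose limit does not vanish on the set
    already found, and restrict to its fixed vectors. Any other [P] is, modulo
    a multiple of [Q], a polynomial whose leading coefficient is nonnegative and
    below [a], so it acts by [0], or as a polynomial of degree at most [d]. *)
Lemma homogeneous_subset d : idempotent_upto d -> forall K, limproj_invariant K ->
  (exists2 f, K f & f <> 0) ->
  exists2 K', [/\ K' `<=` K, limproj_invariant K' & exists2 f, K' f & f <> 0] &
    forall P, poly_le d P ->
      (forall f, K' f -> V P f = f) \/ (forall f, K' f -> V P f = 0).
Proof.
elim: d => [|d IH] idd K Kinv K0.
  exists K; first by split.
  by move=> P /poly_le0 ->; left => f _; exact: limproj0.
have [K1 [sK K1inv [e Ke e0]] K1hom] :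
    exists2 K', [/\ K' `<=` K, limproj_invariant K' & exists2 f, K' f & f <> 0] &
    forall P, poly_le d P ->
      (forall f, K' f -> V P f = f) \/ (forall f, K' f -> V P f = 0).
  by apply: IH => // P f Pd; apply/idd/(poly_leW _ Pd).
pose B a := `[< (0 < a)%N /\ exists Q, [/\ poly_le d.+1 Q, Q`_d.+1 = a%:Z &
  exists2 f, K1 f & V Q f <> 0] >].
have B0 a Q : (0 < a)%N -> ~~ B a -> poly_le d.+1 Q -> Q`_d.+1 = a%:Z ->
    forall f, K1 f -> V Q f = 0.
  move=> a0 /asboolPn nB Ql Qa f Kf; apply: contrapT => Vf; apply: nB.
  by split=> //; exists Q; split=> //; exists f.
have [exB|nB] := pselect (exists a, B a); last first.
  exists K1; first by split => //; exists e.
  move=> Q Ql; have [Q0|Q0] := eqVneq Q`_d.+1 0.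
    exact/K1hom/poly_le_coef0.
  have {}nB a : ~~ B a by apply/negP => Ba; apply: nB; exists a.
  right => f Kf; have [Qp|Qn] := ltrP 0 Q`_d.+1.
    refine (@B0 (absz Q`_d.+1) Q _ (nB _) Ql _ f Kf); first by rewrite absz_gt0.
    by rewrite gtz0_abs.
  apply: (rdot_eq0 (ip := ip)); rewrite -(limproj_normN ip_norm U_unitary).
  rewrite (@B0 (absz Q`_d.+1) (- Q)) ?rdot0l ?absz_gt0 //; first exact: poly_leN.
  by rewrite coefN lez0_abs.
case: (ex_minnP exB) => a /asboolP[a0 [Q [Ql Qa [f0 Kf0 f00]]]] amin.
exists [set f | K1 f /\ V Q f = f].
  split.
  - by move=> f [/sK].
  - move=> P f [Kf Qf]; split; first exact: K1inv.
    by rewrite (limprojC ip_norm U_unitary) Qf.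
  - exists (V Q f0) => //; split; first exact: K1inv.
    exact: idd.
(* On fixed vectors of Q, P acts as its remainder modulo Q. *)
move=> P Pl; pose c := (P`_d.+1 %/ a)%Z; pose P' := P - Q *~ c.
have P'l : poly_le d.+1 P' by apply/poly_le_sub/poly_leMz.
have P'c : P'`_d.+1 = (P`_d.+1 %% a)%Z.
  rewrite coefB coefMrz Qa -mulrzr intz mulrC.
  by rewrite {1}(divz_eq P`_d.+1 a) -/c addrAC subrr add0r.
have VP f : K1 f /\ V Q f = f -> V P f = V P' f.
  move=> [_ Qf]; rewrite -[in LHS](subrK (Q *~ c) P) addrC.
  by rewrite (limproj_fixDl ip_norm U_unitary) // (limproj_fixMz ip_norm U_unitary).
have [r0|r0] := eqVneq (P`_d.+1 %% a)%Z 0.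
  have /K1hom[h|h] : poly_le d P' by apply: poly_le_coef0; rewrite ?P'c.
    by left => f Kf; rewrite VP // h //; case: Kf.
  by right => f Kf; rewrite VP // h //; case: Kf.
right => f Kf; rewrite VP //; have a0' : a%:Z != 0 by rewrite eqz_nat -lt0n.
have r1 := modz_ge0 P`_d.+1 a0'.
have r2 := ltz_mod P`_d.+1 a0'.
have [Kf1 _] := Kf.
refine (@B0 (absz (P`_d.+1 %% a)%Z) P' _ _ P'l _ f Kf1).
- by rewrite absz_gt0.
- by apply/negP => /amin; rewrite leqNgt -ltz_nat gez0_abs // (lt_le_trans r2).
- by rewrite P'c gez0_abs.
Qed.

(** The differences of [P] have lower degree, so each either fixes [f] or kills
    it, and the ultrafilter decides which alternative prevails. If they fix [f]
    for most [m], then [limproj_shift] reads [V P f = V P (V P f)]. If they kill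
    [f], the correlations of [U^(P n) f] vanish and van der Corput gives
    [V P f = 0]. *)
Lemma limproj_fix_or_0_step d P f : poly_le d.+1 P ->
  homogeneous d f -> V P (V P f) = V P f.
Proof.
move=> Pl fhom.
pose A := [set m | V (poly_diff P m) f = f].
have [pA|pA] := in_ultra_setVsetC A pU.
  apply: (rdot_inj (ip := ip)) => g.
  have c1 := @limproj_cvg _ _ _ ip_norm _ U_unitary p pU P (V P f) g.
  have c2 := @limproj_shift _ _ _ ip_norm _ U_unitary p pU pp P f g.
  have c3 : '[V (P + poly_diff P m) f, opow U (- poly_at P m) g] @[m --> p] -->
      '[V P (V P f), g].
    apply: (cvg_trans _ c1); apply: near_eq_cvg; apply: filterS pA => m /= Am.
    by rewrite addrC (limproj_fixDl ip_norm U_unitary) // (rdot_opow_adj U_unitary).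
  exact: cvg_unique c3 c2.
suff -> : V P f = 0 by rewrite (limproj0r ip_norm U_unitary).
apply: (van_der_corput ip_norm pp); first exact: bounded_opow.
apply: filterS pA => m Am.
have Dm0 : V (poly_diff P m) f = 0 by case: (fhom _ (poly_diff_le m Pl)).
have e n : '[opow U (poly_at P (posnat_add n m)) f, opow U (poly_at P n) f] =
    '[opow U (poly_at (poly_diff P m) n) f, opow U (- poly_at P m) f].
  rewrite poly_diffE poly_atD addrCA (opowD U_unitary) (rdot_opow U_unitary).
  by rewrite (opowD U_unitary) (rdot_opow_adj U_unitary).
under eq_cvg do rewrite e.
have := @limproj_cvg _ _ _ ip_norm _ U_unitary p pU (poly_diff P m) f
  (opow U (- poly_at P m) f).
by rewrite Dm0 rdot0l; apply.
Qed.

(** By induction on the degree. The defect [E = V P V P - V P] is a normal operator;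
    if it were nonzero its range would contain a nonzero homogeneous vector for
    the lower degree, on which [E] vanishes by the previous lemma. So [E E] would
    kill some vector that [E] does not, which is impossible for a normal
    operator. *)
Lemma limproj_idempotent P f : P.[0] = 0 -> V P (V P f) = V P f.
Proof.
move=> P0; have : poly_le (size P) P by [].
move: (size P) => d {P0}; elim: d => [|d IH] in P f *.
  by move=> /poly_le0 ->; rewrite !limproj0.
move=> Pl; pose E Q g := V Q (V Q g) - V Q g.
have EV Q Q' g : E Q (V Q' g) = V Q' (E Q g).
  rewrite /E (limprojB ip_norm U_unitary).
  by rewrite -!(limprojC ip_norm U_unitary Q' Q).
have Eadj g h : '[E P g, h] = '[g, E (- P) h].
  by rewrite /E rdotBl rdotBr !(limproj_adj ip_norm U_unitary).
have EB Q x y : E Q (x - y) = E Q x - E Q y.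
  by rewrite /E !(limprojB ip_norm U_unitary) !opprD addrACA.
(* E (- P) is the adjoint of E P, and they commute. *)
have EC g : E (- P) (E P g) = E P (E (- P) g).
  by rewrite [E (- P) (E P g)]/E -!EV -EB.
apply: contrapT => Ef0.
have Kinv : limproj_invariant (range (E P)).
  by move=> Q _ [g _ <-]; rewrite -EV; exists (V Q g).
have [||K' [sK _ [g Kg g0] hom]] := @homogeneous_subset d _ _ Kinv.
- by move=> Q h; exact: IH.
- by exists (E P f); [exists f|move=> /subr0_eq].
have Eg : E P g = 0.
  apply/eqP; rewrite subr_eq0; apply/eqP.
  apply: (limproj_fix_or_0_step Pl) => Q /hom[h|h]; [left|right]; exact: h.
have E0 : E (- P) 0 = 0 by rewrite /E !(limproj0r ip_norm U_unitary) subrr.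
(* g = E P h and E P (E P h) = 0, whence E (- P) (E P h) = 0 by normality. *)
have [h _ hg] := sK _ Kg; apply: g0; rewrite -hg in Eg *.
apply: (rdot_eq0 (ip := ip)); rewrite Eadj.
suff -> : E (- P) (E P h) = 0 by rewrite rdot0r.
by apply: (rdot_eq0 (ip := ip)); rewrite -Eadj -EC Eg E0 rdot0l.
Qed.

(** If a polynomial of degree [r] fixes [f], then up to multiples all
    polynomials of degree at most [r] do. Not all differences of [P] can kill [f],
    for otherwise [limproj_shift] would give [<f, f> = 0]; so some difference, of
    degree exactly [r - 1], fixes [f], and descending induction provides
    fixing polynomials of every degree up to [r]. Elimination of the leading
    coefficient then reduces the degree of an arbitrary [Q]. *)
Lemma fixed_multiple N f r P : f <> 0 -> homogeneous N f ->
  (r <= N)%N -> poly_le r P -> size P = r.+1 -> V P f = f ->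
  forall Q, poly_le r Q -> exists2 s, (0 < s)%N & V (Q *+ s) f = f.
Proof.
move=> f0 fhom; elim: r P => [|r IH] P rN Pr sP Pf Q Qr.
  by exists 1%N => //; rewrite (poly_le0 Qr) limproj0.
have [m Dmf] : exists m, V (poly_diff P m) f = f.
  apply: contrapT => nD.
  have D0 m : V (poly_diff P m) f = 0.
    have [Dmf|//] := fhom _ (poly_leW (ltnW rN) (poly_diff_le m Pr)).
    by exfalso; apply: nD; exists m.
  have c := @limproj_shift _ _ _ ip_norm _ U_unitary p pU pp P f f.
  have e m : '[V (P + poly_diff P m) f, opow U (- poly_at P m) f] = 0.
    by rewrite (limproj_fixDl ip_norm U_unitary) // D0 rdot0l.
  have c0 : cst (0 : R) @ p --> '[V P f, f].
    by rewrite (_ : cst 0 = fun m => '[V (P + poly_diff P m) f,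
      opow U (- poly_at P m) f]) //; apply/funext => m; rewrite e.
  apply: f0; apply: (rdot_eq0 (ip := ip)); rewrite -{1}Pf.
  exact: cvg_unique c0 (cvg_cst 0).
(* For r = 0 the differences of P vanish, but nothing is to be shown. *)
have fixed_low Q' : poly_le r Q' -> exists2 s, (0 < s)%N & V (Q' *+ s) f = f.
  case: r => [|r] in IH rN Pr sP Qr *.
    by move=> /poly_le0 ->; exists 1%N => //; rewrite limproj0.
  apply: (IH (poly_diff P m)) => //; first exact: ltnW.
    exact: poly_diff_le.
  exact: poly_diff_size.
(* The combination a Q - b P has degree at most r, and P already fixes f, so a
   multiple of a Q does; the sign of a is absorbed by passing to the adjoint. *)
set a := P`_r.+1; set b := Q`_r.+1.
have a0 : a != 0.
  have : lead_coef P != 0 by rewrite lead_coef_eq0 -size_poly_eq0 sP.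
  by rewrite lead_coefE sP.
have [|s s0 Qsf] := fixed_low (Q *~ a - P *~ b).
  apply: poly_le_coef0; first by apply: poly_le_sub; apply: poly_leMz.
  by rewrite coefB !coefMrz -[_ *~ a]mulrzr -[_ *~ b]mulrzr !intz mulrC subrr.
have {Qsf} Qasf : V (Q *~ a *+ s) f = f.
  rewrite -[Q *~ a](subrK (P *~ b)) mulrnDl addrC.
  rewrite (limproj_fixDl ip_norm U_unitary) //.
  exact/limproj_fixMn/limproj_fixMz.
exists (absz a * s)%N; first by rewrite muln_gt0 absz_gt0 a0.
rewrite mulrnA -[Q *+ absz a]/(Q *~ (absz a)%:Z).
have [ap|an] := ltrP 0 a; first by rewrite gtz0_abs.
by rewrite lez0_abs // mulrNz mulNrn; apply: limproj_fixN.
Qed.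

(** Were the limit for [P] nonzero on [K], its fixed vectors in [K] would contain
    one homogeneous up to the degree of [P], and [fixed_multiple] would make
    a multiple of [Q] fix it. *)
Lemma zero_of_degree_ge K P Q : limproj_invariant K ->
  Q.[0] = 0 -> (forall s f, (0 < s)%N -> K f -> V (Q *+ s) f = 0) ->
  P.[0] = 0 -> ((size Q).-1 < size P)%N ->
  forall f, K f -> V P f = 0.
Proof.
move=> Kinv Q00 Q0 P0 QP f Kf; apply: contrapT => Pf0.
pose K' := [set g | K g /\ V P g = g].
have K'inv : limproj_invariant K'.
  move=> Q' g [Kg Pg]; split; first exact: Kinv.
  by rewrite (limprojC ip_norm U_unitary) Pg.
pose M := (size P).-1.
have sP : size P = M.+1 by rewrite /M prednK //; case: (size P) QP.
have idM : idempotent_upto M.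
  by move=> S g [S0 _]; apply: limproj_idempotent.
have [|K1 [sK _ [g K1g g0]] hom] := homogeneous_subset idM K'inv.
  exists (V P f) => //; split; first exact: Kinv.
  exact: limproj_idempotent.
have [Kg Pg] := sK _ K1g.
have ghom : homogeneous M g.
  by move=> S /hom[h|h]; [left|right]; exact: h.
have PM : poly_le M P by split; rewrite ?sP.
have QM : poly_le M Q.
  by split => //; rewrite -sP; case: (size Q) QP.
have [s s0 Qsg] := fixed_multiple g0 ghom (leqnn M) PM sP Pg QM.
by apply: g0; rewrite -Qsg Q0.
Qed.

End Homogeneous.

(** * The spaces of vectors with given fixing polynomials *)

Section TypeSpaces.
Context {R : realType} {H : completeNormedModType (Cplx R)}.
Variable ip : {dot H for (@Num.conj (Cplx R))}.
Hypothesis ip_norm : induces_norm ip.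
Variable U : {linear H -> H}.
Hypothesis U_unitary : unitary_op ip U.
Context (p : set_system posnat) {pU : UltraFilter p}.
Hypothesis pp : filter_add p p = p.
Variable N : nat.
Local Notation "'[ f , g ]" := (rdot ip f g) (at level 0).
Local Notation V := (limproj ip U p).

(** The component of the decomposition attached to a set [tau] of polynomials,
    prescribed as those of degree at most [N] whose limit is the identity there. *)
Definition type_space (tau : set {poly int}) : set H :=
  [set f | forall P, poly_le N P ->
     (tau P -> V P f = f) /\ (~ tau P -> V P f = 0)].

(** The index set of the decomposition. Restricting to subsets of [poly_le N] makes
    distinct indices yield orthogonal spaces. *)
Definition types : set (set {poly int}) :=
  [set tau | tau `<=` poly_le N /\ exists2 f, type_space tau f & f <> 0].

Lemma type_space_limproj tau : limproj_invariant ip U p (type_space tau).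
Proof.
move=> P f ft Q Ql; rewrite (limprojC ip_norm U_unitary).
by split=> [/(ft _ Ql).1 -> //|/(ft _ Ql).2 ->]; exact: limproj0r.
Qed.

Lemma type_space_closed tau : closed_subspace (type_space tau).
Proof.
split.
- by move=> P _; split=> _; exact: limproj0r.
- move=> a f g ft gt P Pl; split=> t; rewrite (limproj_lin ip_norm U_unitary).
    by rewrite (ft P Pl).1 // (gt P Pl).1.
  by rewrite (ft P Pl).2 // (gt P Pl).2 // scaler0 addr0.
apply: (rdot_closed ip_norm) => f hf P Pl.
have small h : (forall e : R, 0 < e -> '[h, h] < e) -> h = 0.
  move=> he; apply: contrapT => /(rdot_gt0 ip) h0.
  by have := he _ h0; rewrite ltxx.
split=> t; [apply/eqP; rewrite -subr_eq0; apply/eqP|]; apply: small => e e0.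
  (* V P - 1 has norm at most 2. *)
  have e4 : 0 < e / 4 by rewrite divr_gt0.
  have [g gt hg] := hf _ e4.
  have -> : V P f - f = V P (f - g) - (f - g).
    by rewrite (limprojB ip_norm U_unitary) (gt P Pl).1 // opprB addrA subrK.
  move: (f - g) hg => x hx.
  have h1 := @limproj_contr _ _ _ ip_norm _ U_unitary p pU P x.
  have := rdot_ge0 ip (V P x + x); rewrite rdot_sqB rdot_sqD; lra.
have [g gt hg] := hf _ e0.
have -> : V P f = V P (f - g).
  by rewrite (limprojB ip_norm U_unitary) (gt P Pl).2 // subr0.
exact: le_lt_trans (limproj_contr ip_norm U_unitary _ _) hg.
Qed.

Lemma type_space_U tau : U @` type_space tau = type_space tau.
Proof.
have inv m f : type_space tau f -> type_space tau (opow U m f).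
  move=> ft P Pl; rewrite (limproj_opow ip_norm U_unitary).
  split=> t; first by rewrite (ft P Pl).1.
  rewrite (ft P Pl).2 //; apply: (rdot_eq0 (ip := ip)).
  by rewrite (rdot_opow U_unitary) rdot0l.
apply/seteqP; split=> [_ [f ft <-]|f ft]; first exact: (inv 1 f ft).
exists (opow U (- 1) f); first exact: inv.
exact: (opowNK U_unitary 1 f).
Qed.

(** Move the limit fixing [f] to the other side, where its adjoint kills [g] by
    normality. *)
Lemma type_space_orth_of_mem P tau tau' f g : poly_le N P -> tau P -> ~ tau' P ->
  type_space tau f -> type_space tau' g -> '[f, g] = 0.
Proof.
move=> Pl tP t'P ft gt; rewrite -((ft P Pl).1 tP) (limproj_adj ip_norm U_unitary).
suff -> : V (- P) g = 0 by rewrite rdot0r.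
apply: (rdot_eq0 (ip := ip)).
by rewrite (limproj_normN ip_norm U_unitary) (gt P Pl).2 // rdot0l.
Qed.

Lemma type_space_orth tau tau' f g :
  tau `<=` poly_le N -> tau' `<=` poly_le N -> tau <> tau' ->
  type_space tau f -> type_space tau' g -> '[f, g] = 0.
Proof.
move=> tl t'l tt' ft gt; apply: contrapT => fg; apply: tt'.
apply/seteqP; split=> P tP; apply: contrapT => nP; apply: fg.
  exact: (type_space_orth_of_mem (tl _ tP) tP nP).
by rewrite rdotC; exact: (type_space_orth_of_mem (t'l _ tP) tP nP).
Qed.

(** The reason why the components fill [H]: the orthogonal complement of their
    sum is invariant, so it must vanish. *)
Lemma type_space_meets K :
  limproj_invariant ip U p K -> (exists2 f, K f & f <> 0) ->
  exists tau, exists f, [/\ types tau, type_space tau f, K f & f <> 0].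
Proof.
move=> Kinv K0.
have idN : idempotent_upto ip U p N.
  by move=> S g [S0 _]; apply: (limproj_idempotent ip_norm U_unitary pp).
have [K1 [sK _ [f K1f f0]] hom] := @homogeneous_subset _ _ _ ip_norm _ U_unitary
    p pU N idN K Kinv K0.
have ft : type_space [set P | poly_le N P /\ V P f = f] f.
  move=> P Pl; split=> [[]//|nP].
  by have [h|h] := hom P Pl; [exfalso; apply: nP; split=> //; exact: h|exact: h].
exists [set P | poly_le N P /\ V P f = f], f; split=> //; last exact: sK.
by split; [move=> P []|exists f].
Qed.

Lemma type_space_normalized tau : types tau ->
  exists f, type_space tau f /\ '[f, f] = 1.
Proof.
move=> [_ [f ft f0]]; have [t0 tlin _] := type_space_closed tau.
exists (rc (Num.sqrt '[f, f])^-1 *: f); split.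
  by rewrite -[_ *: _]addr0; exact: tlin.
have ff := rdot_gt0 ip f0.
rewrite rdotZl rdotZr mulrA -invfM -expr2 sqr_sqrtr ?ltW // mulVf //.
by rewrite gt_eqF.
Qed.

(** Unit vectors in different components are at distance [sqrt 2], hence
    points of a countable dense set within [1/2] of them are distinct. *)
Lemma countable_types : separable_space H -> countable types.
Proof.
move=> [D [/countable_injP[h hinj] Dd]].
have approx tau : exists d, types tau -> exists f,
    [/\ type_space tau f, '[f, f] = 1, D d & '[f - d, f - d] < 4^-1].
  have [tt|nt] := pselect (types tau); last by exists 0.
  have [f [ft f1]] := type_space_normalized tt.
  have q0 : 0 < 2^-1 :> R by rewrite invr_gt0.
  have [||d [bd Dd']] := Dd (ball f (rc 2^-1)).
  - by exists f; apply: ballxx; rewrite ltc_rc.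
  - by apply: ball_open; rewrite ltc_rc.
  exists d => _; exists f; split=> //.
  move: bd; rewrite -ball_normE /= (norm_lt_rc ip_norm) //.
  by rewrite expr2 -invfM -natrM.
have /choice[d dP] := approx.
apply/countable_injP; exists (h \o d) => t t'; rewrite !inE => tt tt' /= hd.
have [[f [ft f1 Dt df]] [f' [ft' f1' Dt' df']]] := (dP _ tt, dP _ tt').
have {}hd : d t = d t' by apply: hinj => //; rewrite inE.
apply: contrapT => nt.
(* Otherwise |f - f'|^2 = 2, while both vectors are within 1/2 of the same point. *)
have ff' : '[f, f'] = 0.
  by apply: (type_space_orth _ _ nt ft ft'); [case: tt|case: tt'].
have := rdot_ge0 ip ((f - d t) + (f' - d t)).
rewrite -hd in df'; rewrite rdot_sqD.
have : '[(f - d t) - (f' - d t), (f - d t) - (f' - d t)] = 2.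
  by rewrite opprB addrA subrK rdot_sqB ff' f1 f1'; ring.
rewrite rdot_sqB; move: df df'.
have h2 : 4 * 4^-1 = 1 :> R by rewrite divff.
move: (4^-1) h2 => q h2; lra.
Qed.

End TypeSpaces.

Lemma countable_enumeration (T : pointedType) (S : set T) : countable S ->
  exists I, exists2 e : nat -> T, index_range I & set_bij I S e.
Proof.
move=> cS.
(* Index sets here start at 1, enumerations by nat at 0. *)
have shift (A : set nat) (g : nat -> T) : set_bij A S g ->
    set_bij [set k | (1 <= k)%N /\ A k.-1] S (fun k => g k.-1).
  move=> [gA ginj gsurj]; split.
  - by move=> k [_ Ak]; exact: gA.
  - move=> k l; rewrite !inE => -[k1 Ak] [l1 Al] /ginj; rewrite !inE.
    by move=> /(_ Ak Al) kl; rewrite -(prednK k1) kl prednK.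
  - by move=> t /gsurj[n An <-]; exists n.+1.
have [/finite_setP[K]|iS] := pselect (finite_set S).
  rewrite card_eq_sym => /card_set_bijP[g gb]; have gP := shift _ _ gb.
  exists [set k | (1 <= k <= K)%N], (fun k => g k.-1); first by left; exists K.
  rewrite (_ : mkset _ = [set k | (1 <= k)%N /\ `I_K k.-1]) //.
  by apply/seteqP; split=> [] [|k] //= [].
exists [set k | (1 <= k)%N].
have /card_set_bijP[g gb] : ([set: nat] #= S)%card.
  by rewrite card_eq_sym; exact: eq_card_nat.
have gP := shift _ _ gb.
exists (fun k => g k.-1); first by right.
rewrite (_ : mkset _ = [set k | (1 <= k)%N /\ [set: nat] k.-1]) //.
by apply/seteqP; split=> [k //|k []].
Qed.

(** * Operator limits on a subspace and values of the limit operator *)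

Section WeakOperatorLimits.
Context {R : realType} {H : completeNormedModType (Cplx R)}.
Variable ip : {dot H for (@Num.conj (Cplx R))}.
Hypothesis ip_norm : induces_norm ip.
Variable U : {linear H -> H}.
Hypothesis U_unitary : unitary_op ip U.
Context (p : set_system posnat) {pU : UltraFilter p}.
Local Notation "'[ f , g ]" := (rdot ip f g) (at level 0).
Local Notation V := (limproj ip U p).

Lemma norm_le_Re_Im (z : Cplx R) :
  `|z| <= rc (`|complex.Re (z : R[i])| + `|complex.Im (z : R[i])|).
Proof.
rewrite [z in `|z|]complexE; apply: le_trans (ler_normD _ _) _.
have nr (r : R) : `|(r%:C)%C : Cplx R| = rc `|r|.
  by rewrite normc_def /= expr0n /= addr0 sqrtr_sqr.
rewrite normrM [`|'i%C|]normc_def /= expr0n expr1n add0r sqrtr1 mul1r.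
by rewrite !nr /rc -rmorphD.
Qed.

Lemma cvg_ip (x : posnat -> H) v g :
  (forall h, '[x n, h] @[n --> p] --> '[v, h]) -> ip (x n) g @[n --> p] --> ip v g.
Proof.
move=> xv; apply/cvgrPdist_lt => _ /gt0_rc[e e0 ->].
have e2 : 0 < e / 2 by rewrite divr_gt0.
have /cvgrPdist_lt/(_ _ e2) h1 := xv g.
have /cvgrPdist_lt/(_ _ e2) h2 := xv ((complex.Complex 0 1 : Cplx R) *: g).
apply: filterS (filterI h1 h2) => n [] /=; rewrite -!rdotBl => d1 d2.
have -> : ip v g - ip (x n) g = ip (v - x n) g by rewrite linearBl.
apply: le_lt_trans (norm_le_Re_Im _) _.
rewrite ltc_rc ip_rdot /=; lra.
Qed.

Lemma cvg_rdot_of_ip (x : posnat -> H) v g :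
  ip (x n) g @[n --> p] --> ip v g -> '[x n, g] @[n --> p] --> '[v, g].
Proof.
move=> /cvgrPdist_lt xv; apply/cvgrPdist_lt => e e0.
have c0 : 0 < rc e by rewrite ltc_rc.
apply: filterS (xv _ c0) => n.
have -> : ip v g - ip (x n) g = ip (v - x n) g by rewrite linearBl.
rewrite -rdotBl /rdot => h.
by rewrite -ltc_rc; apply: le_lt_trans h; exact: normc_ge_Re.
Qed.

Lemma plim_pow_id_of_limproj J P :
  (forall f, J f -> V P f = f) -> plim_pow_id ip p U J P.
Proof.
move=> JV f g Jf Jg; apply: cvg_ip => h; rewrite -{2}(JV f Jf).
exact: limproj_cvg.
Qed.

Lemma plim_pow_zero_of_limproj J P :
  (forall f, J f -> V P f = 0) -> plim_pow_zero ip p U J P.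
Proof.
move=> JV f g Jf Jg; apply: cvg_ip => h; rewrite -(JV f Jf).
exact: limproj_cvg.
Qed.

Lemma limproj_of_plim_pow_id J P f : plim_pow_id ip p U J P -> J f -> V P f = f.
Proof.
move=> JP Jf.
have e : '[V P f, f] = '[f, f].
  exact: cvg_unique (@limproj_cvg _ _ _ ip_norm _ U_unitary p pU P f f)
    (cvg_rdot_of_ip (JP f f Jf Jf)).
apply/eqP; rewrite -subr_eq0; apply/eqP/(rdot_eq0 (ip := ip))/eqP.
rewrite eq_le rdot_ge0 andbT rdot_sqB e.
have := @limproj_contr _ _ _ ip_norm _ U_unitary p pU P f; lra.
Qed.

(** For negative powers this needs the equality [U J = J] and not just
    an inclusion. *)
Lemma invariant_opow J m f : U @` J = J -> J f -> J (opow U m f).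
Proof.
move=> UJ; elim/int_ind: m => [//|m IH|m IH] Jf.
  rewrite -addn1 PoszD (opowS U_unitary) -UJ.
  by exists (opow U m f) => //; exact: IH.
have := IH Jf; rewrite -{1}UJ => -[g Jg Ug].
suff -> : opow U (- m.+1%:Z) f = g by [].
apply: (can_inj (unitaryK U_unitary)); rewrite Ug -(opowS U_unitary).
by rewrite -addn1 PoszD opprD addrNK.
Qed.

(** The operator limit on [J] is only tested against vectors of [J], so one must
    first see that [V P f] lies in [J]: all [U^(P n) f] do, and a closed
    subspace is weakly closed, by projecting onto it. *)
Lemma limproj_of_plim_pow_zero J P f : closed_subspace J -> U @` J = J ->
  plim_pow_zero ip p U J P -> J f -> V P f = 0.
Proof.
move=> cJ UJ JP Jf.
(* The part of V P f orthogonal to J is 0, being orthogonal to all U^(P n) f. *)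
have JV : J (V P f).
  have [v Jv vP] := orthogonal_projection ip_norm (V P f) cJ.
  suff e : V P f - v = 0 by rewrite -(subrK v (V P f)) e add0r.
  apply: (rdot_eq0 (ip := ip)); rewrite rdotBr [X in _ - X]vP // subr0.
  rewrite rdotC.
  have c := @limproj_cvg _ _ _ ip_norm _ U_unitary p pU P f (V P f - v).
  have c0 : cst (0 : R) @ p --> '[V P f, V P f - v].
    rewrite (_ : cst 0 = fun n => '[opow U (poly_at P n) f, V P f - v]) //.
    by apply/funext => n; rewrite rdotC vP //; exact: invariant_opow.
  exact: cvg_unique c0 (cvg_cst 0).
apply: (rdot_eq0 (ip := ip)).
have c1 := cvg_rdot_of_ip (JP f (V P f) Jf JV).
have c2 := @limproj_cvg _ _ _ ip_norm _ U_unitary p pU P f (V P f).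
by rewrite (cvg_unique (@Rhausdorff R) c2 c1) rdot0l.
Qed.

End WeakOperatorLimits.

(** * Projection series along orthogonal subspaces *)

Section OrthogonalSeries.
Context {R : realType} {H : completeNormedModType (Cplx R)}.
Variable ip : {dot H for (@Num.conj (Cplx R))}.
Hypothesis ip_norm : induces_norm ip.
Local Notation "'[ f , g ]" := (rdot ip f g) (at level 0).
Variables (I : set nat) (J : nat -> set H).
Hypothesis J_closed : forall k, I k -> closed_subspace (J k).
Hypothesis J_orth : forall k l, I k -> I l -> k <> l ->
  forall f g, J k f -> J l g -> '[f, g] = 0.

Lemma rdot_series (x : nat -> H) k h m :
  (forall k, I k -> J k (x k)) -> (forall k, ~ I k -> x k = 0) ->
  I k -> J k h -> '[series x m, h] = if (k < m)%N then '[x k, h] else 0.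
Proof.
move=> xJ x0 Ik Jh; elim: m => [|m IH].
  by rewrite /series /= big_geq // rdot0l.
rewrite seriesSr /= rdotDl IH ltnS [(k <= m)%N]leq_eqVlt.
have [->|km] := eqVneq k m; first by rewrite ltnn add0r.
have -> : '[x m, h] = 0.
  have [Im|nI] := pselect (I m); last by rewrite x0 // rdot0l.
  by apply: (J_orth Im Ik _ (xJ _ Im) Jh) => e; rewrite e eqxx in km.
by rewrite addr0.
Qed.

(** Bessel's inequality bounds the partial sums of the projections, so they
    converge; the remainder is orthogonal to every component by construction. *)
Lemma orthogonal_series (f : H) : exists x : nat -> H,
  [/\ forall k, I k -> J k (x k), forall k, ~ I k -> x k = 0 &
      exists2 l, series x @ \oo --> l &
        forall k h, I k -> J k h -> '[f - l, h] = 0].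
Proof.
have hx k : exists v, (I k -> J k v /\ forall g, J k g -> '[f - v, g] = 0) /\
    (~ I k -> v = 0).
  have [Ik|nI] := pselect (I k); last by exists 0.
  by have [v Jv vP] := orthogonal_projection ip_norm f (J_closed Ik); exists v.
have /choice[x xP] := hx.
have xJ k : I k -> J k (x k) by move=> /(xP k).1[].
have x0 k : ~ I k -> x k = 0 by move=> /(xP k).2.
have fx k h : I k -> J k h -> '[f, h] = '[x k, h].
  move=> Ik Jh; apply/eqP; rewrite -subr_eq0 -rdotBl; apply/eqP.
  by have [_] := (xP k).1 Ik; apply.
pose a := series (fun k => '[x k, x k]).
have xx k m : '[series x m, x k] = if (k < m)%N then '[x k, x k] else 0.
  have [Ik|nI] := pselect (I k); last by rewrite !x0 // !rdot0r if_same.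
  by apply: rdot_series => //; exact: xJ.
have ss m n : (n <= m)%N -> '[series x m, series x n] = a n.
  move=> nm; rewrite /a /series /= rdot_sumr.
  apply: eq_big_nat => k /= kn; have := xx k m; rewrite /series /= => ->.
  by rewrite (leq_trans kn).
have fs n : '[f, series x n] = a n.
  rewrite /a /series /= rdot_sumr; apply: eq_bigr => k _.
  have [Ik|nI] := pselect (I k); last by rewrite x0 // !rdot0r.
  by rewrite (fx k) //; exact: xJ.
have ab n : a n <= '[f, f].
  by have := rdot_ge0 ip (f - series x n); rewrite rdot_sqB fs ss //; lra.
have aM : nondecreasing_seq a.
  by apply: nondecreasing_series => k _ _; exact: rdot_ge0.
have ac : cvgn a.
  by apply: nondecreasing_is_cvgn => //; exists '[f, f] => _ [n _ <-].
have [l sl] : exists l : H, series x @ \oo --> l.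
  apply: (rdot_complete ip_norm) => e e0.
  have /cvgrPdist_lt/(_ _ e0)[n0 _ hn0] := ac.
  have aL n : a n <= limn a by exact: nondecreasing_cvgn_le.
  (* By orthogonality the squared distance is a m - a n. *)
have dist m n : (n0 <= n)%N -> (n <= m)%N ->
      '[series x m - series x n, series x m - series x n] < e.
    move=> n0n nm; rewrite rdot_sqB !ss //.
    have := hn0 n n0n; rewrite /= ger0_norm ?subr_ge0 //.
    have := aL m; lra.
  exists n0 => m n hm hn; have [nm|/ltnW mn] := leqP n m; first exact: dist.
  by rewrite -opprB rdotNl rdotNr opprK; exact: dist.
exists x; split=> //; exists l => // k h Ik Jh.
have c : '[series x n, h] @[n --> \oo] --> '[l, h] by exact: cvg_rdot.
have c' : '[series x n, h] @[n --> \oo] --> '[x k, h].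
  apply: cvg_near_cst; exists k.+1 => // n /= kn.
  by rewrite (rdot_series _ xJ x0 Ik Jh) kn.
by rewrite rdotBl (cvg_unique (@Rhausdorff R) c c') (fx k) // subrr.
Qed.

End OrthogonalSeries.

(** * The decomposition and its uniqueness *)

Section Decomposition.
Context {R : realType} {H : completeNormedModType (Cplx R)}.
Variable ip : {dot H for (@Num.conj (Cplx R))}.
Hypothesis ip_norm : induces_norm ip.
Variable U : {linear H -> H}.
Hypothesis U_unitary : unitary_op ip U.
Context (p : set_system posnat) {pU : UltraFilter p}.
Hypothesis pp : filter_add p p = p.
Variable N : nat.
Local Notation "'[ f , g ]" := (rdot ip f g) (at level 0).
Local Notation V := (limproj ip U p).
Local Notation type_space := (type_space ip U p N).
Local Notation types := (types ip U p N).

Lemma type_space_decomposition (I : set nat) (e : nat -> set {poly int}) :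
  index_range I -> set_bij I types e ->
  invariant_decomposition ip U I (fun k => type_space (e k)).
Proof.
move=> Irange [eI einj esurj].
have cl k : closed_subspace (type_space (e k)) by exact: type_space_closed.
have orth k l : I k -> I l -> k <> l -> forall f g,
    type_space (e k) f -> type_space (e l) g -> '[f, g] = 0.
  move=> Ik Il kl f g; have [ek _] := eI _ Ik; have [el _] := eI _ Il.
  apply: (type_space_orth ip_norm U_unitary) => // ekl.
  by apply: kl; apply: einj; rewrite ?inE.
split=> // [k Ik|].
  split=> //; first exact: type_space_U.
  have [_ [f ef f0]] := eI _ Ik => e0.
  by apply: f0; move: ef; rewrite e0.
split=> [k l Ik Il kl f g fk gl|f].
  apply: rdot_eq0_ip => a; apply: (orth _ _ Ik Il kl) => //.
  by have [l0 llin _] := cl l; rewrite -[_ *: _]addr0; exact: llin.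
have [x [xJ x0 [l xl lP]]] := orthogonal_series ip_norm (fun k _ => cl k) orth f.
exists x; split=> //.
suff fl0 : f - l = 0 by rewrite -(subrK l f) fl0 add0r.
apply: contrapT => fl.
(* The orthogonal complement of all components meets one of them if nonzero. *)
pose K := [set g | forall k h, I k -> type_space (e k) h -> '[g, h] = 0].
have Kinv : limproj_invariant ip U p K.
  move=> P g Kg k h Ik hk; rewrite (limproj_adj ip_norm U_unitary).
  apply: (Kg k) => //.
  exact: type_space_limproj.
have [|t [g [tt gt Kg g0]]] := type_space_meets ip_norm U_unitary pp N Kinv.
  by exists (f - l).
have [k Ik ek] := esurj _ tt.
apply: g0; apply: (rdot_eq0 (ip := ip)); apply: (Kg k) => //.
by rewrite ek.
Qed.

Lemma zero_or_id_type_space (I : set nat) (e : nat -> set {poly int}) :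
  zero_or_id ip N p U I (fun k => type_space (e k)).
Proof.
move=> P k Pl _; have [eP|neP] := pselect (e k P).
  right; apply: (plim_pow_id_of_limproj ip_norm U_unitary) => f ft.
  by rewrite (ft P Pl).1.
left; apply: (plim_pow_zero_of_limproj ip_norm U_unitary) => f ft.
by rewrite (ft P Pl).2.
Qed.

Lemma distinct_plims_type_space (I : set nat) (e : nat -> set {poly int}) :
  set_bij I types e -> distinct_plims ip N p U I (fun k => type_space (e k)).
Proof.
move=> [eI einj _] k l Ik Il kl; apply: contrapT => nQ; apply: kl.
apply: einj; rewrite ?inE //.
have [ek _] := eI _ Ik; have [el _] := eI _ Il.
have dec m P : poly_le N P ->
    (e m P -> plim_pow_id ip p U (type_space (e m)) P) /\
    (~ e m P -> plim_pow_zero ip p U (type_space (e m)) P).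
  move=> Pl; split=> emP.
    apply: (plim_pow_id_of_limproj ip_norm U_unitary) => f ft.
    by rewrite (ft P Pl).1.
  apply: (plim_pow_zero_of_limproj ip_norm U_unitary) => f ft.
  by rewrite (ft P Pl).2.
apply/seteqP; split=> P eP; apply: contrapT => neP; apply: nQ.
  have Pl := ek _ eP; exists P => //; right.
  by split; [exact: (dec k P Pl).1|exact: (dec l P Pl).2].
have Pl := el _ eP; exists P => //; left.
by split; [exact: (dec k P Pl).2|exact: (dec l P Pl).1].
Qed.

Lemma zero_above_degree_type_space (I : set nat) (e : nat -> set {poly int}) :
  zero_above_degree ip N p U I (fun k => type_space (e k)).
Proof.
move=> k Q Ik Ql Q0 P [P0 QP]; apply: (plim_pow_zero_of_limproj ip_norm U_unitary).
apply: (zero_of_degree_ge ip_norm U_unitary pp _ Ql.1) => //.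
  exact: type_space_limproj.
move=> s f s0 ft.
apply: (limproj_of_plim_pow_zero ip_norm U_unitary _ _ (Q0 s s0) ft).
  exact: type_space_closed.
exact: type_space_U.
Qed.

Section Uniqueness.
Variables (I : set nat) (J : nat -> set H).
Hypothesis J_decomposition : invariant_decomposition ip U I J.
Hypothesis J_zero_or_id : zero_or_id ip N p U I J.
Hypothesis J_distinct : distinct_plims ip N p U I J.

(** Recovers from an arbitrary decomposition the index that the component must
    have. *)
Definition component_type k : set {poly int} :=
  [set P | poly_le N P /\ plim_pow_id ip p U (J k) P].

Lemma component_sub k : I k -> J k `<=` type_space (component_type k).
Proof.
move=> Ik f Jf P Pl; have [_ JI _] := J_decomposition.
have [cJ UJ _] := JI k Ik.
split=> [[_ Pid]|nP]; first exact: (limproj_of_plim_pow_id ip_norm U_unitary Pid).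
have [P0|Pid] := J_zero_or_id Pl Ik; last by exfalso; apply: nP.
exact: (limproj_of_plim_pow_zero ip_norm U_unitary cJ UJ P0).
Qed.

Lemma component_inj k l : I k -> I l ->
  component_type k = component_type l -> k = l.
Proof.
move=> Ik Il kl; apply: contrapT => nkl.
have [_ JI _] := J_decomposition.
have conflict m Q : I m -> plim_pow_zero ip p U (J m) Q ->
    plim_pow_id ip p U (J m) Q -> False.
  move=> Im Q0 Q1; have [cJ UJ Jn0] := JI m Im; apply: Jn0.
  apply/seteqP; split=> [f Jf|_ ->]; last by case: cJ.
  rewrite /= -(limproj_of_plim_pow_id ip_norm U_unitary Q1 Jf).
  exact: (limproj_of_plim_pow_zero ip_norm U_unitary cJ UJ Q0).
have [Q Ql [[Q0 Q1]|[Q1 Q0]]] := J_distinct Ik Il nkl.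
  have : component_type l Q by [].
  by rewrite -kl => -[_]; exact: conflict Q0.
have : component_type k Q by [].
by rewrite kl => -[_]; exact: conflict Q0.
Qed.

Lemma component_type_le k : component_type k `<=` poly_le N.
Proof. by move=> P []. Qed.

(** Expand [f] in the given decomposition: each term lies in a type space other
    than that of [t]. *)
Lemma component_orth f h t x : types t -> type_space t h ->
  (forall k, I k -> J k (x k)) -> (forall k, ~ I k -> x k = 0) ->
  series x @ \oo --> f ->
  (forall k, I k -> component_type k <> t) -> '[f, h] = 0.
Proof.
move=> [tl _] ht xJ x0 xf nt.
have c : '[series x n, h] @[n --> \oo] --> '[f, h] by exact: cvg_rdot.
have c' : '[series x n, h] @[n --> \oo] --> (0 : R).
  apply: cvg_near_cst; apply: nearW => n.
  rewrite rdotC /series /= rdot_sumr big1 // => k _; rewrite rdotC.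
  have [Ik|nI] := pselect (I k); last by rewrite x0 // rdot0l.
  apply: (type_space_orth ip_norm U_unitary _ _ (nt k Ik) _ ht) => //.
    exact: component_type_le.
  by apply: component_sub => //; exact: xJ.
exact: (cvg_unique (@Rhausdorff R) c c').
Qed.

(** Every type occurs, since a vector whose type is absent is orthogonal to
    all components and these span [H]. *)
Lemma component_bij : set_bij I types component_type.
Proof.
have [_ JI [_ Jsum]] := J_decomposition.
split.
- move=> k Ik; split; first exact: component_type_le.
  have [cJ UJ Jn0] := JI k Ik; apply: contrapT => nf; apply: Jn0.
  apply/seteqP; split=> [f Jf|_ ->]; last by case: cJ.
  by apply: contrapT => f0; apply: nf; exists f => //; exact: component_sub.
- by move=> k l; rewrite !inE; exact: component_inj.
- move=> t tt; apply: contrapT => nt.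
  have [tl [f ft f0]] := tt; apply: f0.
  have [x [xJ x0 xf]] := Jsum f.
  apply: (rdot_eq0 (ip := ip)); apply: (component_orth tt ft xJ x0 xf).
  by move=> k Ik kt; apply: nt; exists k.
Qed.

(** A component cannot be a proper part of its type space: all the other components
    lie in other type spaces, so they contribute nothing to the expansion of a
    vector of this one. *)
Lemma component_eq k : I k -> J k = type_space (component_type k).
Proof.
move=> Ik; have [_ JI [Jorth Jsum]] := J_decomposition.
apply/seteqP; split; first exact: component_sub.
move=> f ft; have [x [xJ x0 xf]] := Jsum f.
suff e : f - x k = 0 by rewrite -(subrK (x k) f) e add0r; exact: xJ.
have cls := type_space_closed ip_norm U_unitary N (component_type k) (p := p).
have hk : type_space (component_type k) (f - x k).
  have [_ lin _] := cls; rewrite addrC -scaleN1r; apply: lin => //.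
  by apply: component_sub => //; exact: xJ.
apply: (rdot_eq0 (ip := ip)); move: hk; set h := f - x k => hk.
have c : '[series x n, h] @[n --> \oo] --> '[f, h] by exact: cvg_rdot.
have c' : '[series x n, h] @[n --> \oo] --> '[x k, h].
  apply: cvg_near_cst; exists k.+1 => // n /= kn.
  rewrite rdotC /series /= rdot_sumr (bigD1_seq k) ?iota_uniq //=; last first.
    by rewrite mem_index_iota.
  rewrite big1 ?addr0 => [|l lk]; first exact: rdotC.
  rewrite rdotC.
  have [Il|nI] := pselect (I l); last by rewrite x0 // rdot0l.
  apply: (type_space_orth ip_norm U_unitary (@component_type_le l)
    (@component_type_le k) _ (component_sub Il (xJ l Il)) hk).
  by move=> /(component_inj Il Ik) e; rewrite e eqxx in lk.
by rewrite {1}/h rdotBl (cvg_unique (@Rhausdorff R) c c') subrr.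
Qed.

End Uniqueness.

(** Both index sets are in bijection with the types, and a component is determined
    by its type. *)
Lemma reindex_decomposition (I I' : set nat) (e : nat -> set {poly int}) J' :
  set_bij I types e ->
  invariant_decomposition ip U I' J' -> zero_or_id ip N p U I' J' ->
  distinct_plims ip N p U I' J' ->
  same_up_to_reindexing I (fun k => type_space (e k)) I' J'.
Proof.
move=> [eI einj esurj] dec zi di.
have [cI cinj csurj] := component_bij dec zi di.
have hs k : exists k', I k -> I' k' /\ component_type J' k' = e k.
  have [Ik|nI] := pselect (I k); last by exists 0%N.
  by have [k' Ik' ck'] := csurj _ (eI _ Ik); exists k'.
have /choice[s sP] := hs.
exists s => [|k Ik]; last first.
  by have [Isk <-] := sP _ Ik; rewrite (component_eq dec zi di).
split.
- by move=> k Ik; have [] := sP _ Ik.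
- move=> k l; rewrite !inE => Ik Il skl; apply: einj; rewrite ?inE //.
  by have [_ <-] := sP _ Ik; have [_ <-] := sP _ Il; rewrite skl.
- move=> k' Ik'; have [k Ik ek] := esurj _ (cI _ Ik'); exists k => //.
  have [Isk sk] := sP _ Ik; apply: cinj; rewrite ?inE //.
  by rewrite sk ek.
Qed.

End Decomposition.

Theorem theoremA (R : realType) (H : completeNormedModType (Cplx R))
    (ip : {dot H for (@Num.conj (Cplx R))})
    (ip_norm : induces_norm ip) (H_sep : separable_space H)
    (N : nat) (N_ge1 : (1 <= N)%N)
    (p : set_system posnat) (p_idem : idempotent_ultrafilter p)
    (U : {linear H -> H}) (U_unitary : unitary_op ip U) :
  exists (I : set nat) (J : nat -> set H),
    [/\ invariant_decomposition ip U I J,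
        zero_or_id ip N p U I J,
        distinct_plims ip N p U I J,
        (forall (I' : set nat) (J' : nat -> set H),
           invariant_decomposition ip U I' J' ->
           zero_or_id ip N p U I' J' ->
           distinct_plims ip N p U I' J' ->
           same_up_to_reindexing I J I' J')
      & zero_above_degree ip N p U I J].
Proof.
have [pU pp] := p_idem.
have [I [e Irange ebij]] := countable_enumeration
  (countable_types ip_norm U_unitary (p := p) N H_sep).
exists I, (fun k => type_space ip U p N (e k)); split.
- exact: type_space_decomposition.
- exact: zero_or_id_type_space.
- exact: distinct_plims_type_space.
- by move=> I' J'; exact: reindex_decomposition.
- exact: zero_above_degree_type_space.
Qed.
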